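(* Let $\Sigma$ be the critical catenoid in $B^3$, viewed as an annulus with its induced metric $g$. Let $\bar x:(\Sigma,\bar g)\to B^3$ be a free boundary minimal immersion such that $\bar g=e^{2\varphi}g$ for some function $\varphi\in C^4(\Sigma)$ that is constant along at least one boundary component of $\Sigma$. Then $\bar x(\Sigma)$ is congruent to the critical catenoid.
   Context: $B^3$ denotes the closed unit Euclidean ball centered at the origin of $\mathbb{R}^3$. An annulus is a compact surface with boundary diffeomorphic to $[0,1]\times S^1$. A free boundary minimal immersion $\bar x:(\Sigma,\bar g)\to B^3$ is a smooth minimal isometric immersion (so $\bar g$ is the metric induced by $\bar x$ from the Euclidean metric and the mean curvature vanishes) with $\bar x(\partial\Sigma)\subset\partial B^3$ that meets $\partial B^3$ orthogonally along $\partial\Sigma$, i.e. $d\bar x$ sends the unit exterior conormal at each $p \in \partial\Sigma$ to $\bar x(p)$. The function $\varphi$ with $\bar g=e^{2\varphi}g$ is called the conformal factor. The critical catenoid is the free boundary minimal annulus in $B^3$ parametrized by $x(t,\theta)=a(\cosh t\cos\theta,\cosh t\sin\theta,t)$, $(t,\theta)\in[-T_0,T_0]\times[0,2\pi]$ (with $\theta=0$ and $\theta=2\pi$ identified), where $T_0$ is the unique positive solution of $t\tanh t=1$ and $a=(T_0\cosh T_0)^{-1}$. Two subsets of $B^3$ are congruent if one is the image of the other under an isometry of $\mathbb{R}^3$ preserving $B^3$. *)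

(* Defs.v *)
From Stdlib Require Import Reals.
From Coquelicot Require Import Coquelicot.
Open Scope R_scope.

(** * Euclidean space R^3 *)

Definition vec3 : Type := (R * R * R)%type.

Definition vx (v : vec3) : R := fst (fst v).
Definition vy (v : vec3) : R := snd (fst v).
Definition vz (v : vec3) : R := snd v.

Definition add3 (v w : vec3) : vec3 := (vx v + vx w, vy v + vy w, vz v + vz w).
Definition scal3 (c : R) (v : vec3) : vec3 := (c * vx v, c * vy v, c * vz v).
Definition dot3 (v w : vec3) : R := vx v * vx w + vy v * vy w + vz v * vz w.
Definition norm3 (v : vec3) : R := sqrt (dot3 v v).
Definition dist3 (v w : vec3) : R := norm3 (add3 v (scal3 (-1) w)).
Definition cross3 (v w : vec3) : vec3 :=
  (vy v * vz w - vz v * vy w,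
   vz v * vx w - vx v * vz w,
   vx v * vy w - vy v * vx w).

Definition unit_ball (p : vec3) : Prop := norm3 p <= 1.
Definition unit_sphere (p : vec3) : Prop := norm3 p = 1.

Definition image_of (Phi : vec3 -> vec3) (A : vec3 -> Prop) : vec3 -> Prop :=
  fun p => exists q, A q /\ Phi q = p.
Definition same_set (A B : vec3 -> Prop) : Prop := forall p, A p <-> B p.

Definition isometry3 (Phi : vec3 -> vec3) : Prop :=
  forall p q, dist3 (Phi p) (Phi q) = dist3 p q.

Definition congruent_in_ball (A B : vec3 -> Prop) : Prop :=
  exists Phi : vec3 -> vec3,
    isometry3 Phi /\ same_set (image_of Phi unit_ball) unit_ball /\
    same_set (image_of Phi A) B.

(** * The annulus [-T,T] x R/2piZ

    A function on the annulus is a function of (t, theta) that is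
    2pi-periodic in theta for every t in [-T,T]. *)

Definition in_annulus (T t : R) : Prop := - T <= t <= T.
Definition on_boundary (T t : R) : Prop := t = T \/ t = - T.

Definition well_defined_on_annulus {V : Type} (T : R) (f : R -> R -> V) : Prop :=
  forall t th, in_annulus T t -> f t (th + 2 * PI) = f t th.

Definition d_t (f : R -> R -> R) : R -> R -> R :=
  fun t th => Derive (fun s => f s th) t.
Definition d_th (f : R -> R -> R) : R -> R -> R :=
  fun t th => Derive (fun s => f t s) th.

Fixpoint Ck_on (k : nat) (D : R -> R -> Prop) (f : R -> R -> R) : Prop :=
  (forall t th, D t th -> continuity_2d_pt f t th) /\
  match k with
  | O => True
  | S k' =>
      (forall t th, D t th ->
         ex_derive (fun s => f s th) t /\ ex_derive (fun s => f t s) th) /\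
      Ck_on k' D (d_t f) /\ Ck_on k' D (d_th f)
  end.

(** As usual on a manifold with boundary, C^k up to the boundary means that
    the function extends to a C^k function on a neighbourhood.  Here [f] itself
    stands for such an extension; since its derivatives are continuous, their
    values on [-T,T] x R depend only on the restriction of [f] to that strip,
    so the particular extension is immaterial. *)
Definition Ck_annulus (k : nat) (T : R) (f : R -> R -> R) : Prop :=
  well_defined_on_annulus T f /\
  exists eps, 0 < eps /\ Ck_on k (fun t _ => - T - eps < t < T + eps) f.

(** In [forall k, Ck_annulus k T f] the neighbourhood could shrink with [k];
    here a single one serves all orders. *)
Definition smooth_annulus (T : R) (f : R -> R -> R) : Prop :=
  well_defined_on_annulus T f /\
  exists eps, 0 < eps /\
    forall k, Ck_on k (fun t _ => - T - eps < t < T + eps) f.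

(** * Geometry of a map X from the annulus to R^3 *)

Definition comp3 (c : vec3 -> R) (X : R -> R -> vec3) : R -> R -> R :=
  fun t th => c (X t th).

Definition D_t (X : R -> R -> vec3) : R -> R -> vec3 :=
  fun t th => (d_t (comp3 vx X) t th, d_t (comp3 vy X) t th, d_t (comp3 vz X) t th).
Definition D_th (X : R -> R -> vec3) : R -> R -> vec3 :=
  fun t th => (d_th (comp3 vx X) t th, d_th (comp3 vy X) t th, d_th (comp3 vz X) t th).

Definition smooth_map (T : R) (X : R -> R -> vec3) : Prop :=
  smooth_annulus T (comp3 vx X) /\
  smooth_annulus T (comp3 vy X) /\
  smooth_annulus T (comp3 vz X).

(** Tangent vectors of the annulus are written in the frame (d/dt, d/dtheta). *)
Definition differential (X : R -> R -> vec3) (t th : R) (u : R * R) : vec3 :=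
  add3 (scal3 (fst u) (D_t X t th)) (scal3 (snd u) (D_th X t th)).

Definition induced_metric (X : R -> R -> vec3) (t th : R) (u v : R * R) : R :=
  dot3 (differential X t th u) (differential X t th v).

Definition immersion (T : R) (X : R -> R -> vec3) : Prop :=
  forall t th, in_annulus T t ->
    forall u, differential X t th u = (0, 0, 0) -> u = (0, 0).

Definition unit_normal (X : R -> R -> vec3) (t th : R) : vec3 :=
  let N := cross3 (D_t X t th) (D_th X t th) in scal3 (/ norm3 N) N.

(** Half the trace of the second fundamental form with respect to the
    induced metric. *)
Definition mean_curvature (X : R -> R -> vec3) (t th : R) : R :=
  let E := dot3 (D_t X t th) (D_t X t th) in
  let F := dot3 (D_t X t th) (D_th X t th) in
  let G := dot3 (D_th X t th) (D_th X t th) in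
  let n := unit_normal X t th in
  let L := dot3 (D_t (D_t X) t th) n in
  let M := dot3 (D_th (D_t X) t th) n in
  let N := dot3 (D_th (D_th X) t th) n in
  (E * N - 2 * F * M + G * L) / (2 * (E * G - F * F)).

Definition minimal (T : R) (X : R -> R -> vec3) : Prop :=
  forall t th, in_annulus T t -> mean_curvature X t th = 0.

(** For (t, theta) with t = T or t = -T: d/dtheta spans the tangent line of the
    boundary, and a vector points outwards iff its d/dt-component has the sign
    of t. *)
Definition exterior_unit_conormal (X : R -> R -> vec3) (t th : R) (nu : R * R) : Prop :=
  induced_metric X t th nu nu = 1 /\
  induced_metric X t th nu (0, 1) = 0 /\
  0 < t * fst nu.

Definition image_annulus (T : R) (X : R -> R -> vec3) : vec3 -> Prop :=
  fun p => exists t th, in_annulus T t /\ X t th = p.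

Definition free_boundary_minimal_immersion (T : R) (X : R -> R -> vec3) : Prop :=
  smooth_map T X /\
  immersion T X /\
  minimal T X /\
  (forall t th, in_annulus T t -> unit_ball (X t th)) /\
  (forall t th, on_boundary T t -> unit_sphere (X t th)) /\
  (forall t th nu, on_boundary T t ->
     exterior_unit_conormal X t th nu -> differential X t th nu = X t th).

(** The two metrics are compared at the same point of the annulus:
    the metric induced by [Y] is exp(2 phi) times the one induced by [X]. *)
Definition conformal_factor (T : R) (X Y : R -> R -> vec3) (phi : R -> R -> R) : Prop :=
  forall t th, in_annulus T t -> forall u v,
    induced_metric Y t th u v = exp (2 * phi t th) * induced_metric X t th u v.

Definition constant_on_component (t : R) (phi : R -> R -> R) : Prop :=
  exists c, forall th, phi t th = c.

(** * The critical catenoid *)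

Definition is_critical_T (T : R) : Prop := 0 < T /\ T * tanh T = 1.

Definition catenoid (T : R) : R -> R -> vec3 :=
  fun t th =>
    let a := / (T * cosh T) in
    scal3 a (cosh t * cos th, cosh t * sin th, t).

Definition critical_catenoid (T : R) : vec3 -> Prop := image_annulus T (catenoid T).

(* Main.v *)
Require Import Defs.
From Stdlib Require Import Reals Lra.
From Coquelicot Require Import Coquelicot.
Open Scope R_scope.

(** In the isothermal coordinate [z = t + i th] the immersion [X] is harmonic and
    conformal, so [X_zz . X_zz] is holomorphic.  Orthogonality to the sphere makes
    it real on the boundary, hence constant.  If [phi] is constant on [t = T],
    then [X_t = l X] there with [l] constant, and the curve [X (T, .)] has constant
    speed and constant acceleration on the sphere: it is a circle [C + V], with
    [V'' = - w^2 V].  The Cauchy problem for the Laplace equation has at most one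
    solution (logarithmic convexity of the L^2 norm on the circles [t = const]), so
    [X = (1 + l (t - T)) C + (cosh (w (t - T)) + (l / w) sinh (w (t - T))) V].
    The free boundary conditions on [t = - T] then leave only
    [w T tanh (w T) = 1], i.e. [w = 1], which is the critical catenoid.  The other
    boundary component is reduced to this one by [t -> - t]. *)

(** * Smooth functions on a strip *)

(** For harmonic [X] one has [X_zz = (X_tt - i X_tth) / 2] ([X_tth] is the mixed second derivative),
    so the imaginary part to be killed on the boundary is [X_tt . X_tth]. There [X_t = m X] with
    [m = X . X_t] and [m^2 = |X_th|^2]; differentiating these relations along the boundary makes it
    vanish. Being harmonic, it vanishes everywhere, and Cauchy-Riemann then makes
    [|X_tt|^2 - |X_tth|^2] constant along [t = T]. If [m = l] is constant, [X_tt = - X_thth] and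
    [X_tth = l X_th] turn this into constancy of [|X_thth|]. The obstacle is the boundary: outside
    the closed annulus [X] is an arbitrary smooth extension, neither harmonic nor conformal.
    Identities are therefore differentiated in [t] only in the interior and carried to [t = T] and
    [t = - T] by continuity, and the Cauchy problem on [t = T] needs a quantitative uniqueness
    argument. For zero Cauchy data the integrals of [f_t^2] and [f_th^2] over each circle agree;
    this is exactly what makes the L^2 norm logarithmically convex. *)

Definition strip (b : R) : R -> R -> Prop := fun t _ => - b < t < b.
Definition smooth (b : R) (f : R -> R -> R) : Prop := forall k, Ck_on k (strip b) f.

Lemma locally_in_strip (b t : R) : - b < t < b -> locally t (fun s => - b < s < b).
Proof.
  intros H.
  assert (Hd : 0 < Rmin (t + b) (b - t)) by (apply Rmin_glb_lt; lra).
  exists (mkposreal _ Hd); intros s Hs.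
  change (Rabs (s - t) < Rmin (t + b) (b - t)) in Hs.
  pose proof (Rmin_l (t + b) (b - t)); pose proof (Rmin_r (t + b) (b - t)).
  apply Rabs_def2 in Hs; lra.
Qed.

Lemma locally_2d_strip (b t th : R) (P : R -> R -> Prop) :
  - b < t < b -> (forall s v, - b < s < b -> P s v) -> locally_2d P t th.
Proof.
  intros H HP.
  destruct (locally_in_strip b t H) as [d Hd].
  exists d; intros u v Hu _; apply HP, Hd, Hu.
Qed.

Lemma Ck_on_sub (k : nat) (D D' : R -> R -> Prop) (f : R -> R -> R) :
  (forall t th, D' t th -> D t th) -> Ck_on k D f -> Ck_on k D' f.
Proof.
  intros HD; revert f; induction k as [|k IH]; intros f Hf; simpl in *.
  - split; [intros; apply Hf, HD; assumption | exact I].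
  - destruct Hf as (Hc & Hd & H1 & H2).
    split; [intros; apply Hc, HD; assumption|].
    split; [intros; apply Hd, HD; assumption|].
    split; apply IH; assumption.
Qed.

Lemma Ck_on_ext (k : nat) (b : R) (f g : R -> R -> R) :
  (forall t th, strip b t th -> f t th = g t th) ->
  Ck_on k (strip b) f -> Ck_on k (strip b) g.
Proof.
  revert f g; induction k as [|k IH]; intros f g Hfg Hf; simpl in *.
  - split; [|exact I]; intros t th Ht.
    apply (continuity_2d_pt_ext_loc f); [|apply Hf, Ht].
    apply (locally_2d_strip b); [exact Ht | intros; apply Hfg; assumption].
  - destruct Hf as (Hc & Hd & H1 & H2); repeat split.
    + intros t th Ht; apply (continuity_2d_pt_ext_loc f); [|apply Hc, Ht].
      apply (locally_2d_strip b); [exact Ht | intros; apply Hfg; assumption].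
    + apply (ex_derive_ext_loc (fun s => f s th)).
      * eapply filter_imp; [|apply (locally_in_strip b t H)].
        intros; apply Hfg; assumption.
      * apply (Hd t th H).
    + apply (ex_derive_ext (fun s => f t s)); [intros; apply Hfg, H | apply (Hd t th H)].
    + apply (IH (d_t f)); [|exact H1]; intros t th Ht; apply Derive_ext_loc.
      eapply filter_imp; [|apply (locally_in_strip b t Ht)]; intros; apply Hfg; assumption.
    + apply (IH (d_th f)); [|exact H2]; intros t th Ht; apply Derive_ext; intros; apply Hfg, Ht.
Qed.

(** * The reflection exchanging the two boundary components *)

Definition reflect {V : Type} (f : R -> R -> V) : R -> R -> V := fun t th => f (- t) th.

Lemma is_derive_reflect (f : R -> R) (t l : R) :
  is_derive f (- t) l -> is_derive (fun s => f (- s)) t (- l).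
Proof.
  intros H; replace (- l) with (scal (- 1) l) by (unfold scal; simpl; unfold mult; simpl; ring).
  apply (is_derive_comp f Ropp); [exact H|].
  auto_derive; [exact I | ring].
Qed.

Lemma continuity_2d_pt_reflect (f : R -> R -> R) (t th : R) :
  continuity_2d_pt f (- t) th -> continuity_2d_pt (reflect f) t th.
Proof.
  intros H e; destruct (H e) as [d Hd]; exists d; intros u v Hu Hv.
  apply Hd; [|exact Hv].
  replace (- u - - t) with (- (u - t)) by ring; rewrite Rabs_Ropp; exact Hu.
Qed.

(** The factor [c] makes the induction close: each derivative in [t] of a reflected function brings
    a sign, so [c] becomes [- c]. *)
Lemma Ck_on_reflect (k : nat) (b c : R) (f : R -> R -> R) :
  Ck_on k (strip b) f -> Ck_on k (strip b) (fun t th => c * reflect f t th).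
Proof.
  revert c f; induction k as [|k IH]; intros c f Hf; simpl in *.
  - split; [|exact I]; intros t th Ht.
    apply continuity_2d_pt_mult; [apply continuity_2d_pt_const|].
    apply continuity_2d_pt_reflect, Hf; unfold strip in *; lra.
  - destruct Hf as (Hc & Hd & H1 & H2).
    assert (Hs : forall t th, strip b t th -> strip b (- t) th) by (unfold strip; intros; lra).
    split; [|split; [|split]].
    + intros t th Ht; apply continuity_2d_pt_mult; [apply continuity_2d_pt_const|].
      apply continuity_2d_pt_reflect, Hc, Hs, Ht.
    + intros t th Ht; destruct (Hd _ _ (Hs t th Ht)) as [Ha Hb]; split.
      * apply ex_derive_scal.
        destruct Ha as [l Hl]; exists (- l); apply (is_derive_reflect (fun s => f s th)), Hl.
      * apply ex_derive_scal; exact Hb.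
    + apply (Ck_on_ext k b (fun t th => - c * reflect (d_t f) t th)); [|apply IH, H1].
      intros t th Ht; symmetry; apply is_derive_unique.
      replace (- c * reflect (d_t f) t th) with (c * - (reflect (d_t f) t th)) by ring.
      apply (is_derive_scal (fun s => reflect f s th)).
      apply (is_derive_reflect (fun s => f s th)), Derive_correct.
      apply (Hd _ _ (Hs t th Ht)).
    + apply (Ck_on_ext k b (fun t th => c * reflect (d_th f) t th)); [|apply IH, H2].
      intros t th Ht; symmetry.
      apply (Derive_scal (fun s => f (- t) s)).
Qed.

Lemma smooth_reflect (b : R) (f : R -> R -> R) : smooth b f -> smooth b (reflect f).
Proof.
  intros H k; apply (Ck_on_ext k b (fun t th => 1 * reflect f t th)).
  - intros; ring.
  - apply Ck_on_reflect, H.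
Qed.

Section Smooth.
Variables (b : R) (f : R -> R -> R).
Hypothesis Hf : smooth b f.

Lemma smooth_continuous (t th : R) : - b < t < b -> continuity_2d_pt f t th.
Proof. intros Ht; apply (Hf O); exact Ht. Qed.

Lemma smooth_d_t : smooth b (d_t f).
Proof. intros k; apply (Hf (S k)). Qed.

Lemma smooth_d_th : smooth b (d_th f).
Proof. intros k; apply (Hf (S k)). Qed.

Lemma smooth_is_derive_t (t th : R) :
  - b < t < b -> is_derive (fun s => f s th) t (d_t f t th).
Proof.
  intros Ht; destruct (Hf 1%nat) as (_ & H & _); apply Derive_correct, (proj1 (H t th Ht)).
Qed.

Lemma smooth_is_derive_th (t th : R) :
  - b < t < b -> is_derive (fun s => f t s) th (d_th f t th).
Proof.
  intros Ht; destruct (Hf 1%nat) as (_ & H & _); apply Derive_correct, (proj2 (H t th Ht)).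
Qed.
End Smooth.

Lemma smooth_schwarz (b : R) (f : R -> R -> R) (t th : R) :
  smooth b f -> - b < t < b -> d_t (d_th f) t th = d_th (d_t f) t th.
Proof.
  intros Hf Ht; apply Schwarz.
  - apply (locally_2d_strip b); [exact Ht|]; intros u v Hu; repeat split.
    + eexists; apply (smooth_is_derive_t b f Hf u v Hu).
    + eexists; apply (smooth_is_derive_th b f Hf u v Hu).
    + eexists; apply (smooth_is_derive_t b _ (smooth_d_th b f Hf) u v Hu).
    + eexists; apply (smooth_is_derive_th b _ (smooth_d_t b f Hf) u v Hu).
  - apply (smooth_continuous b _ (smooth_d_t b _ (smooth_d_th b f Hf)) t th Ht).
  - apply (smooth_continuous b _ (smooth_d_th b _ (smooth_d_t b f Hf)) t th Ht).
Qed.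

Lemma smooth_is_derive_th_t (b : R) (f : R -> R -> R) (t th : R) :
  smooth b f -> - b < t < b ->
  is_derive (fun s => d_th f s th) t (d_th (d_t f) t th).
Proof.
  intros Hf Ht; rewrite <- (smooth_schwarz b f t th Hf Ht).
  apply (smooth_is_derive_t b _ (smooth_d_th b f Hf) t th Ht).
Qed.

Lemma d_t_reflect (b : R) (f : R -> R -> R) (t th : R) :
  smooth b f -> - b < t < b -> d_t (reflect f) t th = - d_t f (- t) th.
Proof.
  intros Hf Ht; apply is_derive_unique, (is_derive_reflect (fun s => f s th)).
  apply (smooth_is_derive_t b f Hf); lra.
Qed.

Lemma d_tt_reflect (b : R) (f : R -> R -> R) (t th : R) :
  smooth b f -> - b < t < b -> d_t (d_t (reflect f)) t th = d_t (d_t f) (- t) th.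
Proof.
  intros Hf Ht; apply is_derive_unique.
  apply (is_derive_ext_loc (fun s => - d_t f (- s) th)).
  - eapply filter_imp; [|apply (locally_in_strip b t Ht)].
    intros s Hs; symmetry; apply (d_t_reflect b); assumption.
  - replace (d_t (d_t f) (- t) th) with (opp (- d_t (d_t f) (- t) th))
      by (unfold opp; simpl; ring).
    apply (is_derive_opp (fun s => d_t f (- s) th)).
    apply (is_derive_reflect (fun s => d_t f s th)).
    apply (smooth_is_derive_t b _ (smooth_d_t b f Hf)); lra.
Qed.

(** Carries identities from the open annulus to its boundary circles, where a derivative in [t] also
    sees the extension outside. *)
Lemma continuity_closure (f : R -> R) (T t : R) :
  0 < T -> (forall s, - T < s < T -> f s = 0) -> continuity_pt f t ->
  - T <= t <= T -> f t = 0.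
Proof.
  intros HT H0 Hc Ht.
  destruct (Req_dec (f t) 0) as [|Hn]; [assumption|exfalso].
  destruct (Hc (Rabs (f t)) (Rabs_pos_lt _ Hn)) as (d & Hd & H).
  set (h := Rmin (d / 2) T).
  assert (Hh : 0 < h) by (apply Rmin_glb_lt; lra).
  pose proof (Rmin_l (d / 2) T); pose proof (Rmin_r (d / 2) T); fold h in H1, H2.
  assert (exists s, - T < s < T /\ s <> t /\ Rabs (s - t) < d) as (s & Hs & Hst & Hsd).
  (* The nearby point is taken towards the middle of the interval; [h <= T] keeps it strictly
     inside. *)
  { destruct (Rle_dec t 0).
    - exists (t + h / 2); repeat split; try lra.
      replace (t + h / 2 - t) with (h / 2) by ring; rewrite Rabs_pos_eq; lra.
    - exists (t - h / 2); repeat split; try lra.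
      replace (t - h / 2 - t) with (- (h / 2)) by ring; rewrite Rabs_Ropp, Rabs_pos_eq; lra. }
  assert (Hk := H s); simpl in Hk; unfold Rdist in Hk.
  rewrite (H0 s Hs) in Hk.
  replace (0 - f t) with (- f t) in Hk by ring; rewrite Rabs_Ropp in Hk.
  apply (Rlt_irrefl (Rabs (f t))), Hk; split; [split; [exact I | auto] | exact Hsd].
Qed.

Lemma continuity_2d_pt_t (f : R -> R -> R) (t th : R) :
  continuity_2d_pt f t th -> continuity_pt (fun s => f s th) t.
Proof.
  intros H e He; destruct (H (mkposreal e He)) as [d Hd].
  exists d; split; [apply cond_pos|]; intros s [_ Hs]; simpl in *; unfold Rdist in *.
  apply Hd; [exact Hs | rewrite Rminus_diag, Rabs_R0; apply cond_pos].
Qed.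

Lemma continuity_2d_pt_th (f : R -> R -> R) (t th : R) :
  continuity_2d_pt f t th -> continuity_pt (fun s => f t s) th.
Proof.
  intros H e He; destruct (H (mkposreal e He)) as [d Hd].
  exists d; split; [apply cond_pos|]; intros s [_ Hs]; simpl in *; unfold Rdist in *.
  apply Hd; [rewrite Rminus_diag, Rabs_R0; apply cond_pos | exact Hs].
Qed.

(** * Convexity and parametric integrals *)

Lemma mvt_open (L L1 : R -> R) (a b : R) : a < b ->
  (forall t, a <= t <= b -> continuity_pt L t) ->
  (forall t, a < t < b -> is_derive L t (L1 t)) ->
  exists s, a < s < b /\ L b - L a = L1 s * (b - a).
Proof.
  intros Hab Hc Hd.
  destruct (MVT L id a b (fun t Ht => exist _ (L1 t) (proj1 (is_derive_Reals L t (L1 t)) (Hd t Ht)))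
    (fun t Ht => derivable_pt_id t) Hab Hc (fun t Ht => derivable_continuous_pt _ _ (derivable_pt_id t)))
    as (s & Hs & H).
  exists s; split; [exact Hs|].
  rewrite derive_pt_id in H; unfold derive_pt, id in H; simpl in H; lra.
Qed.

(** The mean slopes on the two sides of [t] are attained at points [s < t < r], and [L1] is
    nondecreasing. The derivatives are required in the interior only, since the equations behind
    [L2] hold only there. *)
Lemma convex_chord (T : R) (L L1 L2 : R -> R) :
  (forall t, - T <= t <= T -> continuity_pt L t) ->
  (forall t, - T < t < T -> is_derive L t (L1 t)) ->
  (forall t, - T < t < T -> is_derive L1 t (L2 t)) ->
  (forall t, - T < t < T -> 0 <= L2 t) ->
  forall t, - T < t < T -> 2 * T * L t <= (T - t) * L (- T) + (T + t) * L T.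
Proof.
  intros Hc H1 H2 Hp t Ht.
  destruct (mvt_open L L1 (- T) t) as (s & Hs & Es);
    [lra | intros; apply Hc; lra | intros; apply H1; lra |].
  destruct (mvt_open L L1 t T) as (r & Hr & Er);
    [lra | intros; apply Hc; lra | intros; apply H1; lra |].
  destruct (mvt_open L1 L2 s r) as (q & Hq & Eq);
    [lra | | intros; apply H2; lra |].
  { intros u Hu; apply derivable_continuous_pt.
    exists (L2 u); apply is_derive_Reals, H2; lra. }
  assert (0 <= L2 q * (r - s)) by (apply Rmult_le_pos; [apply Hp|]; lra).
  (* This product is exactly the gap between the two sides of the chord inequality. *)
  assert (0 <= (L1 r - L1 s) * ((t + T) * (T - t))).
  { apply Rmult_le_pos; [lra|]; apply Rmult_le_pos; lra. }
  replace (L T) with (L t + L1 r * (T - t)) by lra.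
  replace (L (- T)) with (L t - L1 s * (t - - T)) by lra.
  nra.
Qed.

(** Convexity of [ln (E + e)] on [[-T, T]] for every [e > 0] turns [E T = 0]
    into [E = 0] in the interior, by letting [e] tend to 0. *)
Lemma log_convex_vanish (T : R) (E E1 E2 : R -> R) :
  0 < T ->
  (forall t, - T <= t <= T -> continuity_pt E t) ->
  (forall t, - T < t < T -> is_derive E t (E1 t)) ->
  (forall t, - T < t < T -> is_derive E1 t (E2 t)) ->
  (forall t, - T <= t <= T -> 0 <= E t) ->
  (forall t, - T < t < T -> 0 <= E2 t) ->
  (forall t, - T < t < T -> E1 t * E1 t <= E t * E2 t) ->
  E T = 0 -> forall t, - T < t < T -> E t = 0.
Proof.
  intros HT Hc H1 H2 Hp Hp2 Hcs HE t Ht.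
  destruct (Req_dec (E t) 0) as [|Hn]; [assumption | exfalso].
  assert (HEt : 0 < E t) by (assert (0 <= E t) by (apply Hp; lra); lra).
  assert (Hchord : forall e, 0 < e ->
    2 * T * ln (E t + e) <= (T - t) * ln (E (- T) + e) + (T + t) * ln (E T + e)).
  { intros e He.
    apply (convex_chord T (fun s => ln (E s + e)) (fun s => E1 s / (E s + e))
      (fun s => (E2 s * (E s + e) - E1 s * E1 s) / (E s + e) ^ 2)); [ | | | | exact Ht].
    - intros s Hs; apply (continuity_pt_comp (fun s => E s + e) ln).
      + apply continuity_pt_plus; [apply Hc, Hs | apply continuity_pt_const; intros ? ?; reflexivity].
      + apply derivable_continuous_pt; exists (/ (E s + e)).
        apply derivable_pt_lim_ln; specialize (Hp s Hs); lra.
    - intros s Hs; assert (0 <= E s) by (apply Hp; lra).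
      pose proof (H1 s Hs) as D.
      auto_derive; [split; [eexists; exact D | split; [lra | exact I]]|].
      change (fun x => E x) with E.
      rewrite (is_derive_unique _ _ _ D); field; lra.
    - intros s Hs; assert (0 <= E s) by (apply Hp; lra).
      pose proof (H1 s Hs) as D; pose proof (H2 s Hs) as D2.
      auto_derive; [repeat split; try (eexists; eassumption); lra|].
      change (fun x => E x) with E; change (fun x => E1 x) with E1.
      rewrite (is_derive_unique _ _ _ D), (is_derive_unique _ _ _ D2); field; lra.
    (* The numerator is [(E E2 - E1^2) + e E2], a sum of two nonnegative terms. *)
    - intros s Hs; assert (0 <= E s) by (apply Hp; lra).
      specialize (Hcs s Hs); specialize (Hp2 s Hs).
      apply Rmult_le_pos; [nra | left; apply Rinv_0_lt_compat; nra]. }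
  (* [A] is the lower bound on [ln e] that the chord inequality gives for every [e <= 1]; taking
     [e <= exp (A - 1)] contradicts it. *)
  set (A := (2 * T * ln (E t) - (T - t) * ln (E (- T) + 1)) / (T + t)).
  set (e := Rmin 1 (exp (A - 1))).
  assert (He : 0 < e) by (apply Rmin_glb_lt; [lra | apply exp_pos]).
  pose proof (Rmin_l 1 (exp (A - 1))) as He1; pose proof (Rmin_r 1 (exp (A - 1))) as He2.
  fold e in He1, He2.
  specialize (Hchord e He); rewrite HE, Rplus_0_l in Hchord.
  assert (ln (E t) <= ln (E t + e)) by (left; apply ln_increasing; lra).
  assert (0 <= E (- T)) by (apply Hp; lra).
  assert (ln (E (- T) + e) <= ln (E (- T) + 1)) by (apply ln_le; lra).
  assert (ln e <= A - 1) by (rewrite <- (ln_exp (A - 1)); apply ln_le; lra).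
  assert ((T + t) * ln e <= (T + t) * (A - 1)) by (apply Rmult_le_compat_l; lra).
  assert ((T + t) * A = 2 * T * ln (E t) - (T - t) * ln (E (- T) + 1))
    by (unfold A; field; lra).
  assert ((T - t) * ln (E (- T) + e) <= (T - t) * ln (E (- T) + 1))
    by (apply Rmult_le_compat_l; lra).
  assert (2 * T * ln (E t) <= 2 * T * ln (E t + e)) by (apply Rmult_le_compat_l; lra).
  lra.
Qed.

(** A function together with named derivatives up to order 2, so that sums, products and separated
    functions get theirs by explicit formulas. The single field [fth] serves both orders of mixed
    differentiation. *)
Record jet2 (b : R) (f ft fh ftt fth fhh : R -> R -> R) : Prop := Jet2 {
  jet_t : forall t th, - b < t < b -> is_derive (fun s => f s th) t (ft t th);
  jet_h : forall t th, - b < t < b -> is_derive (fun s => f t s) th (fh t th);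
  jet_tt : forall t th, - b < t < b -> is_derive (fun s => ft s th) t (ftt t th);
  jet_th : forall t th, - b < t < b -> is_derive (fun s => ft t s) th (fth t th);
  jet_ht : forall t th, - b < t < b -> is_derive (fun s => fh s th) t (fth t th);
  jet_hh : forall t th, - b < t < b -> is_derive (fun s => fh t s) th (fhh t th);
  jet_c : forall t th, - b < t < b -> continuity_2d_pt f t th;
  jet_ct : forall t th, - b < t < b -> continuity_2d_pt ft t th;
  jet_ch : forall t th, - b < t < b -> continuity_2d_pt fh t th;
  jet_ctt : forall t th, - b < t < b -> continuity_2d_pt ftt t th;
  jet_cth : forall t th, - b < t < b -> continuity_2d_pt fth t th;
  jet_chh : forall t th, - b < t < b -> continuity_2d_pt fhh t th }.

Lemma smooth_jet2 (b : R) (f : R -> R -> R) : smooth b f ->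
  jet2 b f (d_t f) (d_th f) (d_t (d_t f)) (d_th (d_t f)) (d_th (d_th f)).
Proof.
  intros Hf; pose proof (smooth_d_t b f Hf) as Ht; pose proof (smooth_d_th b f Hf) as Hh.
  split; intros t th Hb.
  - apply (smooth_is_derive_t b); assumption.
  - apply (smooth_is_derive_th b); assumption.
  - apply (smooth_is_derive_t b); assumption.
  - apply (smooth_is_derive_th b); assumption.
  - apply (smooth_is_derive_th_t b); assumption.
  - apply (smooth_is_derive_th b); assumption.
  - apply (smooth_continuous b); assumption.
  - apply (smooth_continuous b); assumption.
  - apply (smooth_continuous b); assumption.
  - apply (smooth_continuous b); [apply smooth_d_t|]; assumption.
  - apply (smooth_continuous b); [apply smooth_d_th|]; assumption.
  - apply (smooth_continuous b); [apply smooth_d_th|]; assumption.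
Qed.

(** * Integrals over a period, depending on the parameter [t] *)

Lemma continuity_pt_continuous (f : R -> R) (x : R) : continuity_pt f x -> continuous f x.
Proof. intros H; apply continuity_pt_filterlim; exact H. Qed.

Lemma ex_RInt_strip (b : R) (F : R -> R -> R) (t c d : R) :
  (forall s th, - b < s < b -> continuity_2d_pt F s th) ->
  - b < t < b -> ex_RInt (F t) c d.
Proof.
  intros H Ht; apply (@ex_RInt_continuous R_CompleteNormedModule); intros z _.
  apply continuity_pt_continuous, continuity_2d_pt_th, H, Ht.
Qed.

Lemma is_derive_RInt_strip (b : R) (F Ft : R -> R -> R) (c d t : R) :
  (forall s th, - b < s < b -> is_derive (fun u => F u th) s (Ft s th)) ->
  (forall s th, - b < s < b -> continuity_2d_pt F s th) ->
  (forall s th, - b < s < b -> continuity_2d_pt Ft s th) ->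
  - b < t < b -> is_derive (fun s => RInt (F s) c d) t (RInt (Ft t) c d).
Proof.
  intros HD HF HFt Ht.
  rewrite (RInt_ext (Ft t) (fun th => Derive (fun u => F u th) t)).
  2:{ intros th _; symmetry; apply is_derive_unique, HD, Ht. }
  apply (is_derive_RInt_param F).
  - eapply filter_imp; [|apply (locally_in_strip b t Ht)].
    intros s Hs th _; eexists; apply HD, Hs.
  - intros th _; apply (continuity_2d_pt_ext_loc Ft); [|apply HFt, Ht].
    apply (locally_2d_strip b); [exact Ht|]; intros; symmetry; apply is_derive_unique, HD; assumption.
  - eapply filter_imp; [|apply (locally_in_strip b t Ht)].
    intros s Hs; apply (ex_RInt_strip b); assumption.
Qed.

Lemma RInt_derive_periodic (F F' : R -> R) (c : R) :
  (forall th, is_derive F th (F' th)) -> (forall th, continuity_pt F' th) ->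
  F (c + 2 * PI) = F c -> RInt F' c (c + 2 * PI) = 0.
Proof.
  intros HD HC HP.
  rewrite (is_RInt_unique F' c (c + 2 * PI) (minus (F (c + 2 * PI)) (F c))).
  - rewrite HP; unfold minus, plus, opp; simpl; ring.
  - apply (@is_RInt_derive R_CompleteNormedModule); intros; [apply HD | apply continuity_pt_continuous, HC].
Qed.

(** By nonnegativity the integral from [c] to any [y] in the interval is squeezed to 0, so its
    derivative [f x * f x] is 0. *)
Lemma RInt_sqr_zero (f : R -> R) (c d : R) :
  (forall x, continuity_pt f x) -> RInt (fun x => f x * f x) c d = 0 ->
  forall x, c < x < d -> f x = 0.
Proof.
  intros Hf H0 x Hx.
  assert (Hc : forall y, continuous (fun y => f y * f y) y).
  { intros y; apply continuity_pt_continuous, continuity_pt_mult; apply Hf. }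
  assert (He : forall u v, ex_RInt (fun y => f y * f y) u v)
    by (intros; apply (@ex_RInt_continuous R_CompleteNormedModule); intros; apply Hc).
  assert (Hp : forall u v, u <= v -> 0 <= RInt (fun y => f y * f y) u v)
    by (intros; apply RInt_ge_0; [assumption | apply He | intros; nra]).
  assert (HF : forall y, c <= y <= d -> RInt (fun y => f y * f y) c y = 0).
  { intros y Hy; pose proof (RInt_Chasles _ _ _ _ (He c y) (He y d)) as HC.
    unfold plus in HC; simpl in HC; rewrite H0 in HC.
    pose proof (Hp c y (proj1 Hy)); pose proof (Hp y d (proj2 Hy)); lra. }
  assert (HD : is_derive (fun y => RInt (fun z => f z * f z) c y) x (f x * f x)).
  { apply (is_derive_RInt (fun z => f z * f z) _ c); [|apply Hc].
    apply filter_forall; intros y; apply (@RInt_correct R_CompleteNormedModule), He. }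
  assert (HZ : is_derive (fun y => RInt (fun z => f z * f z) c y) x 0).
  { apply (is_derive_ext_loc (fun _ => 0)); [|apply (is_derive_const 0 x)].
    assert (Hd : 0 < Rmin (x - c) (d - x)) by (apply Rmin_glb_lt; lra).
    exists (mkposreal _ Hd); intros y Hy; symmetry; apply HF.
    change (Rabs (y - x) < Rmin (x - c) (d - x)) in Hy.
    pose proof (Rmin_l (x - c) (d - x)); pose proof (Rmin_r (x - c) (d - x)).
    apply Rabs_def2 in Hy; lra. }
  apply is_derive_unique in HD; apply is_derive_unique in HZ.
  rewrite HZ in HD; nra.
Qed.

(** * Harmonic functions on the annulus *)

(* Coquelicot states equations of integrals in a normed module, where [ring] fails. *)
Ltac ring_R := simpl; match goal with |- @eq _ ?a ?b => change (@eq R a b) end; ring.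

Lemma RInt_linear (F G : R -> R) (u v c d : R) :
  ex_RInt F c d -> ex_RInt G c d ->
  RInt (fun x => u * F x + v * G x) c d = u * RInt F c d + v * RInt G c d.
Proof.
  intros HF HG; apply is_RInt_unique.
  apply (is_RInt_plus (fun x => u * F x) (fun x => v * G x) c d).
  - apply (is_RInt_scal F c d u), (@RInt_correct R_CompleteNormedModule), HF.
  - apply (is_RInt_scal G c d v), (@RInt_correct R_CompleteNormedModule), HG.
Qed.

Lemma is_derive_mult_R (F G : R -> R) (x dF dG : R) :
  is_derive F x dF -> is_derive G x dG -> is_derive (fun y => F y * G y) x (dF * G x + F x * dG).
Proof. intros HF HG; apply (is_derive_mult F G); [exact HF | exact HG | intros; apply Rmult_comm]. Qed.

Lemma RInt_cauchy_schwarz (F G : R -> R) (c d : R) : c <= d ->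
  ex_RInt (fun x => F x * F x) c d -> ex_RInt (fun x => F x * G x) c d ->
  ex_RInt (fun x => G x * G x) c d ->
  RInt (fun x => F x * G x) c d * RInt (fun x => F x * G x) c d
  <= RInt (fun x => F x * F x) c d * RInt (fun x => G x * G x) c d.
Proof.
  intros Hcd HFF HFG HGG.
  set (p := RInt (fun x => F x * F x) c d); set (q := RInt (fun x => F x * G x) c d);
    set (r := RInt (fun x => G x * G x) c d).
  (* The quadratic form is the integral of [(u F + v G)^2]; Cauchy-Schwarz is the sign of its
     discriminant. *)
  assert (HQ : forall u v, 0 <= u * u * p + 2 * u * v * q + v * v * r).
  { intros u v.
    replace (u * u * p + 2 * u * v * q + v * v * r) with
      (RInt (fun x => (u * u) * (F x * F x) + 1 * ((2 * u * v) * (F x * G x) + (v * v) * (G x * G x))) c d).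
    - apply RInt_ge_0; [exact Hcd| |intros x _; pose proof (Rle_0_sqr (u * F x + v * G x)); unfold Rsqr in *; lra].
      apply (ex_RInt_plus (fun x => u * u * (F x * F x)) (fun x => 1 * (2 * u * v * (F x * G x) + v * v * (G x * G x)))).
      + apply (ex_RInt_scal (fun x => F x * F x) c d (u * u)), HFF.
      + apply (ex_RInt_scal (fun x => 2 * u * v * (F x * G x) + v * v * (G x * G x)) c d 1).
        apply (ex_RInt_plus (fun x => 2 * u * v * (F x * G x)) (fun x => v * v * (G x * G x)));
          [apply (ex_RInt_scal (fun x => F x * G x) c d (2 * u * v)), HFG
          |apply (ex_RInt_scal (fun x => G x * G x) c d (v * v)), HGG].
    - rewrite (RInt_linear (fun x => F x * F x) (fun x => 2 * u * v * (F x * G x) + v * v * (G x * G x)) (u * u) 1).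
      + rewrite (RInt_linear (fun x => F x * G x) (fun x => G x * G x) (2 * u * v) (v * v) c d HFG HGG).
        unfold p, q, r; ring_R.
      + exact HFF.
      + apply (ex_RInt_plus (fun x => 2 * u * v * (F x * G x)) (fun x => v * v * (G x * G x)));
          [apply (ex_RInt_scal (fun x => F x * G x) c d (2 * u * v)), HFG
          |apply (ex_RInt_scal (fun x => G x * G x) c d (v * v)), HGG]. }
  pose proof (HQ 1 0); pose proof (HQ 0 1).
  destruct (Req_dec r 0) as [Hr|Hr].
  - pose proof (HQ 1 ((p + 1) / 2)); pose proof (HQ 1 (- ((p + 1) / 2))).
    destruct (Req_dec q 0) as [Hq|Hq]; [rewrite Hq, Hr; lra|].
    pose proof (HQ 1 (- (p + 1) / (2 * q))) as H'.
    (* With [r = 0] and [q <> 0] the form is affine in [v]; this [v] gives it the value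
       [p - (p + 1) = -1]. *)
    rewrite Hr in H'.
    replace (1 * 1 * p + 2 * 1 * (- (p + 1) / (2 * q)) * q + - (p + 1) / (2 * q) * (- (p + 1) / (2 * q)) * 0)
      with (-1) in H' by (field; exact Hq); lra.
  (* At [(r, - q)] the form equals [r (p r - q^2)]. *)
  - pose proof (HQ r (- q)) as H'.
    assert (0 <= r * (p * r - q * q)) by lra.
    assert (0 < r) by lra.
    assert (0 <= p * r - q * q); [|lra].
    apply (Rmult_le_reg_l r); lra.
Qed.

Section Harmonic.
Variables (T b : R) (f ft fh ftt fth fhh : R -> R -> R).
Hypothesis HT : 0 < T.
Hypothesis HTb : T < b.
Hypothesis HJ : jet2 b f ft fh ftt fth fhh.
Hypothesis Hper : forall t th, - T <= t <= T -> f t (th + 2 * PI) = f t th.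
Hypothesis Hharm : forall t th, - T < t < T -> ftt t th + fhh t th = 0.

Lemma jet2_h_periodic (t th : R) : - T <= t <= T -> fh t (th + 2 * PI) = fh t th.
Proof.
  intros Ht; transitivity (Derive (fun s => f t s) th).
  2:{ apply is_derive_unique, (jet_h _ _ _ _ _ _ _ HJ); lra. }
  symmetry; apply is_derive_unique.
  apply (is_derive_ext (fun s => f t (s + 2 * PI))); [intros; apply Hper, Ht|].
  replace (fh t (th + 2 * PI)) with (scal 1 (fh t (th + 2 * PI)))
    by (unfold scal; simpl; unfold mult; ring_R).
  apply (is_derive_comp (fun s => f t s) (fun s => s + 2 * PI)).
  - apply (jet_h _ _ _ _ _ _ _ HJ); lra.
  - auto_derive; [exact I | ring].
Qed.

Lemma jet2_t_periodic (t th : R) : - T < t < T -> ft t (th + 2 * PI) = ft t th.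
Proof.
  intros Ht; transitivity (Derive (fun s => f s th) t).
  2:{ apply is_derive_unique, (jet_t _ _ _ _ _ _ _ HJ); lra. }
  symmetry; apply is_derive_unique.
  apply (is_derive_ext_loc (fun s => f s (th + 2 * PI))).
  - eapply filter_imp; [|apply (locally_in_strip T t Ht)]; intros s Hs; apply Hper; lra.
  - apply (jet_t _ _ _ _ _ _ _ HJ); lra.
Qed.

Variable c : R.
(** The starting point [c] of the period stays free, so that a given angle can later be placed in
    the interior of the integration window. *)
Let I (F : R -> R -> R) (t : R) : R := RInt (F t) c (c + 2 * PI).

Ltac cont2 :=
  repeat first [apply continuity_2d_pt_mult | apply continuity_2d_pt_minus
    | apply continuity_2d_pt_plus | apply continuity_2d_pt_const
    | eapply jet_c; [exact HJ|] | eapply jet_ct; [exact HJ|] | eapply jet_ch; [exact HJ|]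
    | eapply jet_ctt; [exact HJ|] | eapply jet_cth; [exact HJ|] | eapply jet_chh; [exact HJ|]];
  try lra.

Ltac cont1 := simpl;
  repeat first [apply continuity_pt_mult | apply continuity_pt_minus | apply continuity_pt_plus
    | apply (continuity_2d_pt_th f) | apply (continuity_2d_pt_th ft) | apply (continuity_2d_pt_th fh)
    | apply (continuity_2d_pt_th ftt) | apply (continuity_2d_pt_th fth) | apply (continuity_2d_pt_th fhh)];
  cont2.

Ltac exI := apply (@ex_RInt_continuous R_CompleteNormedModule); intros;
  apply continuity_pt_continuous; cont1.

Lemma energy_derive (t : R) : - b < t < b ->
  is_derive (I (fun t th => f t th * f t th)) t (2 * I (fun t th => f t th * ft t th) t).
Proof.
  intros Ht.
  evar_last; [unfold I; apply (is_derive_RInt_strip b _ (fun t th => ft t th * f t th + f t th * ft t th))|].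
  - intros; apply (is_derive_mult_R (fun s => f s th) (fun s => f s th)); apply (jet_t _ _ _ _ _ _ _ HJ); assumption.
  - intros; cont2.
  - intros; cont2.
  - exact Ht.
  - unfold I; rewrite (RInt_ext _ (fun th => 1 * (f t th * ft t th) + 1 * (f t th * ft t th)))
      by (intros; ring_R).
    rewrite RInt_linear by exI; ring_R.
Qed.

Lemma energy_derive2 (t : R) : - T < t < T ->
  is_derive (I (fun t th => f t th * ft t th)) t
    (I (fun t th => ft t th * ft t th) t + I (fun t th => fh t th * fh t th) t).
Proof.
  intros Ht.
  evar_last; [unfold I; apply (is_derive_RInt_strip b _ (fun t th => ft t th * ft t th + f t th * ftt t th))|].
  - intros; apply (is_derive_mult_R (fun s => f s th) (fun s => ft s th));
      [apply (jet_t _ _ _ _ _ _ _ HJ) | apply (jet_tt _ _ _ _ _ _ _ HJ)]; assumption.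
  - intros; cont2.
  - intros; cont2.
  - lra.
  (* Integration by parts over a period: harmonicity replaces [f f_tt] by [- f f_thth], whose
     integral is that of [f_th^2]. *)
  - assert (HI : RInt (fun th => fh t th * fh t th + f t th * fhh t th) c (c + 2 * PI) = 0).
    { apply (RInt_derive_periodic (fun th => f t th * fh t th)).
      - intros; apply (is_derive_mult_R (f t) (fh t)); [apply (jet_h _ _ _ _ _ _ _ HJ) | apply (jet_hh _ _ _ _ _ _ _ HJ)]; lra.
      - intros; cont1.
      - rewrite Hper, jet2_h_periodic by lra; reflexivity. }
    assert (HI2 : RInt (fun th => fh t th * fh t th + f t th * fhh t th) c (c + 2 * PI)
      = RInt (fun th => fh t th * fh t th) c (c + 2 * PI) - RInt (fun th => f t th * ftt t th) c (c + 2 * PI)).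
    { rewrite (RInt_ext _ (fun th => 1 * (fh t th * fh t th) + (-1) * (f t th * ftt t th))).
      - rewrite RInt_linear by exI; ring_R.
      - intros th _; pose proof (Hharm t th Ht); simpl; replace (ftt t th) with (- fhh t th) by lra; ring. }
    rewrite HI in HI2.
    unfold I; rewrite (RInt_ext _ (fun th => 1 * (ft t th * ft t th) + 1 * (f t th * ftt t th)))
      by (intros; ring_R).
    rewrite RInt_linear by exI; simpl; lra.
Qed.

Lemma period_le : c <= c + 2 * PI.
Proof. pose proof PI_RGT_0; lra. Qed.

Lemma energy_continuous (t : R) : - b < t < b -> continuity_pt (I (fun t th => f t th * f t th)) t.
Proof.
  intros Ht; apply derivable_continuous_pt; eexists; apply is_derive_Reals, energy_derive, Ht.
Qed.

Lemma energy_nonneg (F : R -> R -> R) (t : R) : - b < t < b ->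
  (forall s th, - b < s < b -> continuity_2d_pt F s th) -> 0 <= I (fun t th => F t th * F t th) t.
Proof.
  intros Ht HF; apply RInt_ge_0; [apply period_le | | intros; nra].
  apply (ex_RInt_strip b (fun t th => F t th * F t th)); [intros; apply continuity_2d_pt_mult; apply HF; lra | exact Ht].
Qed.

(** The energy is convex, nonnegative and zero at both ends. *)
Lemma energy_dirichlet :
  (forall th, f T th = 0) -> (forall th, f (- T) th = 0) ->
  forall t, - T < t < T -> I (fun t th => f t th * f t th) t = 0.
Proof.
  intros H1 H2 t Ht.
  assert (HE : forall s, (forall th, f s th = 0) -> I (fun t th => f t th * f t th) s = 0).
  { intros s Hs; unfold I.
    rewrite (RInt_ext _ (fun th => 0 * (f T th * f T th) + 0 * (f T th * f T th)))
      by (intros; simpl; rewrite Hs; ring_R).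
    rewrite RInt_linear by exI; ring_R. }
  pose proof (convex_chord T (I (fun t th => f t th * f t th))
    (fun t => 2 * I (fun t th => f t th * ft t th) t)
    (fun t => 2 * (I (fun t th => ft t th * ft t th) t + I (fun t th => fh t th * fh t th) t))) as HC.
  assert (0 <= I (fun t th => f t th * f t th) t) by (apply energy_nonneg; [lra | intros; cont2]).
  assert (2 * T * I (fun t th => f t th * f t th) t <= 0); [|nra].
  eapply Rle_trans; [apply HC; [| | | |exact Ht] | rewrite (HE T H1), (HE (- T) H2); lra].
  - intros s Hs; apply energy_continuous; lra.
  - intros s Hs; apply energy_derive; lra.
  - intros s Hs; apply is_derive_scal, energy_derive2, Hs.
  - intros s Hs.
    assert (0 <= I (fun t th => ft t th * ft t th) s) by (apply energy_nonneg; [lra | intros; cont2]).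
    assert (0 <= I (fun t th => fh t th * fh t th) s) by (apply energy_nonneg; [lra | intros; cont2]).
    lra.
Qed.

(** The difference of the two integrals is the integral over a circle of the real part of the
    holomorphic function [(f_t - i f_th)^2], hence independent of [t]; it is 0 at [T] because the
    gradient vanishes there. *)
Lemma hopf_integral_const :
  (forall th, ft T th = 0) -> (forall th, fh T th = 0) ->
  forall t, - T < t < T -> I (fun t th => ft t th * ft t th) t = I (fun t th => fh t th * fh t th) t.
Proof.
  intros H1 H2 t Ht.
  set (J := I (fun t th => ft t th * ft t th - fh t th * fh t th)).
  assert (HJ' : forall s, - b < s < b ->
    J s = I (fun t th => ft t th * ft t th) s - I (fun t th => fh t th * fh t th) s).
  { intros s Hs; unfold J, I.
    rewrite (RInt_ext _ (fun th => 1 * (ft s th * ft s th) + (-1) * (fh s th * fh s th)))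
      by (intros; ring_R).
    rewrite RInt_linear by exI; ring_R. }
  assert (HD : forall s, - b < s < b -> is_derive J s
    (RInt (fun th => (ftt s th * ft s th + ft s th * ftt s th) -
                   (fth s th * fh s th + fh s th * fth s th)) c (c + 2 * PI))).
  { intros s Hs; unfold J, I.
    apply (is_derive_RInt_strip b _ (fun s th => (ftt s th * ft s th + ft s th * ftt s th) -
                   (fth s th * fh s th + fh s th * fth s th))).
    - intros u th Hu; apply (is_derive_minus (fun s => ft s th * ft s th) (fun s => fh s th * fh s th)).
      + apply (is_derive_mult_R (fun s => ft s th) (fun s => ft s th)); apply (jet_tt _ _ _ _ _ _ _ HJ); exact Hu.
      + apply (is_derive_mult_R (fun s => fh s th) (fun s => fh s th)); apply (jet_ht _ _ _ _ _ _ _ HJ); exact Hu.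
    - intros; cont2.
    - intros; cont2.
    - exact Hs. }
  destruct (mvt_open J (fun s => RInt (fun th => (ftt s th * ft s th + ft s th * ftt s th) -
                   (fth s th * fh s th + fh s th * fth s th)) c (c + 2 * PI)) t T) as (s & Hs & Es).
  - lra.
  - intros s Hs; apply derivable_continuous_pt; eexists; apply is_derive_Reals, HD; lra.
  - intros s Hs; apply HD; lra.
  - assert (HI : RInt (fun th => fth s th * fh s th + ft s th * fhh s th) c (c + 2 * PI) = 0).
    { apply (RInt_derive_periodic (fun th => ft s th * fh s th)).
      - intros; apply (is_derive_mult_R (ft s) (fh s)); [apply (jet_th _ _ _ _ _ _ _ HJ) | apply (jet_hh _ _ _ _ _ _ _ HJ)]; lra.
      - intros; cont1.
      - rewrite jet2_t_periodic, jet2_h_periodic by lra; reflexivity. }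
    (* Harmonicity makes the integrand [- 2] times the [th]-derivative of [f_t f_th], which
       integrates to 0 over a period. *)
    rewrite (RInt_ext _ (fun th => (-2) * (fth s th * fh s th + ft s th * fhh s th)
        + 0 * (fth s th * fh s th + ft s th * fhh s th))) in Es.
    + rewrite RInt_linear, HI in Es by exI.
      assert (JT : J T = 0).
      { unfold J, I.
        rewrite (RInt_ext _ (fun th => 0 * (f T th * f T th) + 0 * (f T th * f T th)))
          by (intros; simpl; rewrite H1, H2; ring_R).
        rewrite RInt_linear by exI; ring_R. }
      specialize (HJ' t); lra.
    + intros th _; pose proof (Hharm s th); simpl.
      replace (ftt s th) with (- fhh s th) by lra; ring.
Qed.

Lemma energy_cauchy :
  (forall th, f T th = 0) -> (forall th, ft T th = 0) -> (forall th, fh T th = 0) ->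
  forall t, - T < t < T -> I (fun t th => f t th * f t th) t = 0.
Proof.
  intros H0 H1 H2.
  apply (log_convex_vanish T _ (fun t => 2 * I (fun t th => f t th * ft t th) t)
    (fun t => 2 * (I (fun t th => ft t th * ft t th) t + I (fun t th => fh t th * fh t th) t)) HT).
  - intros s Hs; apply energy_continuous; lra.
  - intros s Hs; apply energy_derive; lra.
  - intros s Hs; apply is_derive_scal, energy_derive2, Hs.
  - intros s Hs; apply energy_nonneg; [lra | intros; cont2].
  - intros s Hs.
    assert (0 <= I (fun t th => ft t th * ft t th) s) by (apply energy_nonneg; [lra | intros; cont2]).
    assert (0 <= I (fun t th => fh t th * fh t th) s) by (apply energy_nonneg; [lra | intros; cont2]).
    lra.
  (* With equal integrals the second derivative of the energy is 4 times the integral of [f_t^2],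
     and [E1^2 <= E E2] becomes Cauchy-Schwarz for [f] and [f_t]. *)
  - intros s Hs; rewrite <- hopf_integral_const by assumption.
    assert (I (fun t th => f t th * ft t th) s * I (fun t th => f t th * ft t th) s <=
      I (fun t th => f t th * f t th) s * I (fun t th => ft t th * ft t th) s).
    { apply (RInt_cauchy_schwarz (f s) (ft s)); [apply period_le | exI | exI | exI]. }
    lra.
  - unfold I; rewrite (RInt_ext _ (fun th => 0 * (f T th * f T th) + 0 * (f T th * f T th)))
      by (intros; simpl; rewrite H0; ring_R).
    rewrite RInt_linear by exI; ring_R.
Qed.
End Harmonic.

Section Vanishing.
Variables (T b : R) (f ft fh ftt fth fhh : R -> R -> R).
Hypothesis HT : 0 < T.
Hypothesis HTb : T < b.
Hypothesis HJ : jet2 b f ft fh ftt fth fhh.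
Hypothesis Hper : forall t th, - T <= t <= T -> f t (th + 2 * PI) = f t th.
Hypothesis Hharm : forall t th, - T < t < T -> ftt t th + fhh t th = 0.

Let pointwise :
  (forall c t, - T < t < T -> RInt (fun th => f t th * f t th) c (c + 2 * PI) = 0) ->
  forall t th, - T <= t <= T -> f t th = 0.
Proof.
  intros HE t th Ht; pose proof PI_RGT_0.
  apply (continuity_closure (fun s => f s th) T t HT); [| |exact Ht].
  (* The window of length [2 PI] is centred at [th]. *)
  - intros s Hs; apply (RInt_sqr_zero (f s) (th - PI) (th - PI + 2 * PI)); [|apply HE, Hs | lra].
    intros x; apply continuity_2d_pt_th, (jet_c _ _ _ _ _ _ _ HJ); lra.
  - apply continuity_2d_pt_t, (jet_c _ _ _ _ _ _ _ HJ); lra.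
Qed.

Lemma harmonic_dirichlet :
  (forall th, f T th = 0) -> (forall th, f (- T) th = 0) ->
  forall t th, - T <= t <= T -> f t th = 0.
Proof.
  intros H1 H2; apply pointwise; intros c.
  exact (energy_dirichlet T b f ft fh ftt fth fhh HT HTb HJ Hper Hharm c H1 H2).
Qed.

Lemma harmonic_cauchy :
  (forall th, f T th = 0) -> (forall th, ft T th = 0) ->
  forall t th, - T <= t <= T -> f t th = 0.
Proof.
  intros H0 H1.
  assert (H2 : forall th, fh T th = 0).
  { intros th; transitivity (Derive (fun s => f T s) th).
    - symmetry; apply is_derive_unique, (jet_h _ _ _ _ _ _ _ HJ); lra.
    - rewrite (Derive_ext _ (fun _ => 0)) by apply H0; apply Derive_const. }
  apply pointwise; intros c.
  exact (energy_cauchy T b f ft fh ftt fth fhh HT HTb HJ Hper Hharm c H0 H1 H2).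
Qed.

(** On the boundary circles vanishing is known from one side only, so the value of [ft] there comes
    from its continuity. *)
Lemma jet2_vanish_t :
  (forall t th, - T <= t <= T -> f t th = 0) ->
  forall t th, - T <= t <= T -> ft t th = 0.
Proof.
  intros H0 t th Ht.
  apply (continuity_closure (fun s => ft s th) T t HT); [| |exact Ht].
  - intros s Hs; transitivity (Derive (fun u => f u th) s).
    + symmetry; apply is_derive_unique, (jet_t _ _ _ _ _ _ _ HJ); lra.
    + rewrite (Derive_ext_loc _ (fun _ => 0)); [apply Derive_const|].
      eapply filter_imp; [|apply (locally_in_strip T s Hs)]; intros; apply H0; lra.
  - apply continuity_2d_pt_t, (jet_ct _ _ _ _ _ _ _ HJ); lra.
Qed.

Lemma jet2_vanish_h :
  (forall t th, - T <= t <= T -> f t th = 0) ->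
  forall t th, - T <= t <= T -> fh t th = 0.
Proof.
  intros H0 t th Ht; transitivity (Derive (fun s => f t s) th).
  - symmetry; apply is_derive_unique, (jet_h _ _ _ _ _ _ _ HJ); lra.
  - rewrite (Derive_ext _ (fun _ => 0)) by (intros; apply H0, Ht); apply Derive_const.
Qed.
End Vanishing.

(** * Vector calculus *)

Ltac vec := unfold dot3, add3, scal3, cross3, vx, vy, vz in *; simpl in *.

Lemma vec3_ext (u v : vec3) : vx u = vx v -> vy u = vy v -> vz u = vz v -> u = v.
Proof. destruct u as [[a b] c], v as [[a' b'] c']; unfold vx, vy, vz; simpl; intros; subst; reflexivity. Qed.

Lemma dot3_pos (u : vec3) : dot3 u u = 0 -> u = (0, 0, 0).
Proof.
  destruct u as [[x y] z]; vec; intros H.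
  assert (x = 0) by nra; assert (y = 0) by nra; assert (z = 0) by nra; subst; reflexivity.
Qed.

(** The right side is the Gram determinant, so linear independence can be read off from inner
    products alone. *)
Lemma triple_sqr (a b c : vec3) :
  dot3 c (cross3 a b) ^ 2 =
  dot3 a a * (dot3 b b * dot3 c c - dot3 b c ^ 2)
  - dot3 a b * (dot3 a b * dot3 c c - dot3 b c * dot3 a c)
  + dot3 a c * (dot3 a b * dot3 b c - dot3 b b * dot3 a c).
Proof. destruct a as [[? ?] ?], b as [[? ?] ?], c as [[? ?] ?]; vec; ring. Qed.

Lemma orthogonal_to_basis (a b c w : vec3) :
  dot3 c (cross3 a b) <> 0 ->
  dot3 w a = 0 -> dot3 w b = 0 -> dot3 w c = 0 -> w = (0, 0, 0).
Proof.
  intros Hd Ha Hb Hc.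
  (* Expansion of [w] in the basis reciprocal to [a], [b], [c], cleared of the determinant. *)
  assert (E : scal3 (dot3 c (cross3 a b)) w =
    add3 (scal3 (dot3 w a) (cross3 b c)) (add3 (scal3 (dot3 w b) (cross3 c a)) (scal3 (dot3 w c) (cross3 a b)))).
  { destruct a as [[? ?] ?], b as [[? ?] ?], c as [[? ?] ?], w as [[? ?] ?].
    apply vec3_ext; vec; ring. }
  rewrite Ha, Hb, Hc in E.
  set (d := dot3 c (cross3 a b)) in *.
  destruct w as [[x y] z].
  assert (H : forall s, d * s = 0 -> s = 0) by (intros s Hs; apply Rmult_integral in Hs; tauto).
  apply vec3_ext; apply H; vec; injection E; intros; lra.
Qed.

(** Quantifying over the three projections lets scalar lemmas be applied once for all coordinates of
    a vector. *)
Definition coord (c : vec3 -> R) : Prop := c = vx \/ c = vy \/ c = vz.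

Lemma coord_ext (u v : vec3) : (forall c, coord c -> c u = c v) -> u = v.
Proof. intros H; apply vec3_ext; apply H; unfold coord; auto. Qed.

Lemma coord_add3 (c : vec3 -> R) (u v : vec3) : coord c -> c (add3 u v) = c u + c v.
Proof. intros [-> | [-> | ->]]; reflexivity. Qed.

Lemma coord_scal3 (c : vec3 -> R) (k : R) (u : vec3) : coord c -> c (scal3 k u) = k * c u.
Proof. intros [-> | [-> | ->]]; reflexivity. Qed.

Lemma dot3_comm (u v : vec3) : dot3 u v = dot3 v u.
Proof. unfold dot3; ring. Qed.

Lemma dot3_add_l (u v w : vec3) : dot3 (add3 u v) w = dot3 u w + dot3 v w.
Proof. vec; ring. Qed.

Lemma dot3_scal_l (k : R) (u w : vec3) : dot3 (scal3 k u) w = k * dot3 u w.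
Proof. vec; ring. Qed.

Lemma dot3_add_r (u v w : vec3) : dot3 w (add3 u v) = dot3 w u + dot3 w v.
Proof. vec; ring. Qed.

Lemma dot3_scal_r (k : R) (u w : vec3) : dot3 w (scal3 k u) = k * dot3 w u.
Proof. vec; ring. Qed.

Definition is_derive3 (U : R -> vec3) (t : R) (u : vec3) : Prop :=
  forall c, coord c -> is_derive (fun s => c (U s)) t (c u).

Lemma is_derive_dot3 (U W : R -> vec3) (t : R) (u w : vec3) :
  is_derive3 U t u -> is_derive3 W t w ->
  is_derive (fun s => dot3 (U s) (W s)) t (dot3 u (W t) + dot3 (U t) w).
Proof.
  intros HU HW; unfold dot3.
  replace (vx u * vx (W t) + vy u * vy (W t) + vz u * vz (W t) +
           (vx (U t) * vx w + vy (U t) * vy w + vz (U t) * vz w))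
    with ((vx u * vx (W t) + vx (U t) * vx w) + (vy u * vy (W t) + vy (U t) * vy w)
          + (vz u * vz (W t) + vz (U t) * vz w)) by ring.
  apply (is_derive_plus (fun s => vx (U s) * vx (W s) + vy (U s) * vy (W s)) (fun s => vz (U s) * vz (W s)));
    [apply (is_derive_plus (fun s => vx (U s) * vx (W s)) (fun s => vy (U s) * vy (W s)))|];
    apply is_derive_mult_R; first [apply HU | apply HW]; unfold coord; auto.
Qed.

Lemma is_derive3_scal (k : R -> R) (U : R -> vec3) (t dk : R) (u : vec3) :
  is_derive k t dk -> is_derive3 U t u ->
  is_derive3 (fun s => scal3 (k s) (U s)) t (add3 (scal3 dk (U t)) (scal3 (k t) u)).
Proof.
  intros Hk HU c Hc.
  rewrite coord_add3, !coord_scal3 by exact Hc.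
  apply (is_derive_ext (fun s => k s * c (U s))); [intros; symmetry; apply coord_scal3, Hc|].
  apply is_derive_mult_R; [exact Hk | apply HU, Hc].
Qed.

Lemma is_derive3_unique (U W : R -> vec3) (t : R) (u w : vec3) :
  (forall s, U s = W s) -> is_derive3 U t u -> is_derive3 W t w -> u = w.
Proof.
  intros HUW HU HW; apply coord_ext; intros c Hc.
  rewrite <- (is_derive_unique _ _ _ (HU c Hc)), <- (is_derive_unique _ _ _ (HW c Hc)).
  apply Derive_ext; intros; rewrite HUW; reflexivity.
Qed.

Lemma derive_eq_loc (f g : R -> R) (x df dg : R) :
  locally x (fun s => f s = g s) -> is_derive f x df -> is_derive g x dg -> df = dg.
Proof.
  intros H Hf Hg; rewrite <- (is_derive_unique _ _ _ Hf), <- (is_derive_unique _ _ _ Hg).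
  apply Derive_ext_loc, H.
Qed.

Lemma derive_eq (f g : R -> R) (x df dg : R) :
  (forall s, f s = g s) -> is_derive f x df -> is_derive g x dg -> df = dg.
Proof. intros H; apply derive_eq_loc, filter_forall, H. Qed.

Lemma derive_eq_const (f : R -> R) (k x df : R) :
  (forall s, f s = k) -> is_derive f x df -> df = 0.
Proof. intros H Hf; apply (derive_eq f (fun _ => k) x df 0 H Hf), (is_derive_const k x). Qed.

Lemma derive_eq_const_conv (f f' : R -> R) :
  (forall s, is_derive f s (f' s)) -> (forall s, f' s = 0) -> forall x y, f x = f y.
Proof.
  intros H H0 x y.
  destruct (MVT_gen f x y f') as (s & _ & Hs); [intros; apply H | |rewrite H0 in Hs; lra].
  intros; apply derivable_continuous_pt; eexists; apply is_derive_Reals, H.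
Qed.

Definition smooth3 (b : R) (X : R -> R -> vec3) : Prop :=
  forall c, coord c -> smooth b (comp3 c X).

Lemma comp3_D_t (c : vec3 -> R) (X : R -> R -> vec3) : coord c -> comp3 c (D_t X) = d_t (comp3 c X).
Proof. intros [-> | [-> | ->]]; reflexivity. Qed.

Lemma comp3_D_th (c : vec3 -> R) (X : R -> R -> vec3) : coord c -> comp3 c (D_th X) = d_th (comp3 c X).
Proof. intros [-> | [-> | ->]]; reflexivity. Qed.

Lemma smooth3_D_t (b : R) (X : R -> R -> vec3) : smooth3 b X -> smooth3 b (D_t X).
Proof. intros H c Hc; rewrite comp3_D_t by exact Hc; apply smooth_d_t, H, Hc. Qed.

Lemma smooth3_D_th (b : R) (X : R -> R -> vec3) : smooth3 b X -> smooth3 b (D_th X).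
Proof. intros H c Hc; rewrite comp3_D_th by exact Hc; apply smooth_d_th, H, Hc. Qed.

Lemma smooth3_is_derive_t (b : R) (X : R -> R -> vec3) (t th : R) :
  smooth3 b X -> - b < t < b -> is_derive3 (fun s => X s th) t (D_t X t th).
Proof.
  intros H Ht c Hc; change (c (D_t X t th)) with (comp3 c (D_t X) t th); rewrite comp3_D_t by exact Hc.
  apply (smooth_is_derive_t b _ (H c Hc) t th Ht).
Qed.

Lemma smooth3_is_derive_th (b : R) (X : R -> R -> vec3) (t th : R) :
  smooth3 b X -> - b < t < b -> is_derive3 (fun s => X t s) th (D_th X t th).
Proof.
  intros H Ht c Hc; change (c (D_th X t th)) with (comp3 c (D_th X) t th); rewrite comp3_D_th by exact Hc.
  apply (smooth_is_derive_th b _ (H c Hc) t th Ht).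
Qed.

Lemma smooth3_is_derive_th_t (b : R) (X : R -> R -> vec3) (t th : R) :
  smooth3 b X -> - b < t < b -> is_derive3 (fun s => D_th X s th) t (D_th (D_t X) t th).
Proof.
  intros H Ht c Hc; change (c (D_th (D_t X) t th)) with (comp3 c (D_th (D_t X)) t th).
  rewrite comp3_D_th, comp3_D_t by exact Hc.
  apply (is_derive_ext (fun s => d_th (comp3 c X) s th)).
  - intros s; rewrite <- comp3_D_th by exact Hc; reflexivity.
  - apply (smooth_is_derive_th_t b); [apply H, Hc | exact Ht].
Qed.

Lemma smooth3_continuous (b : R) (X : R -> R -> vec3) (c : vec3 -> R) (t th : R) :
  smooth3 b X -> coord c -> - b < t < b -> continuity_2d_pt (fun t th => c (X t th)) t th.
Proof. intros H Hc Ht; apply (smooth_continuous b (comp3 c X)); [apply H, Hc | exact Ht]. Qed.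

Lemma dot3_continuous (b : R) (X Y : R -> R -> vec3) (t th : R) :
  smooth3 b X -> smooth3 b Y -> - b < t < b ->
  continuity_2d_pt (fun t th => dot3 (X t th) (Y t th)) t th.
Proof.
  intros HX HY Ht; unfold dot3.
  repeat apply continuity_2d_pt_plus; apply continuity_2d_pt_mult;
    apply (smooth3_continuous b); unfold coord; auto.
Qed.

(** * Harmonic functions and the algebra of second-order jets *)

Definition harm (T : R) (f : R -> R -> R) : Prop :=
  forall t th, - T < t < T -> d_t (d_t f) t th + d_th (d_th f) t th = 0.

(** Mixed derivatives are written with [d_th] outermost. In this normal form equal terms of the
    product in [hopf_jet2] are syntactically equal, as [ring] requires. *)
Lemma jet2_d_th (b : R) (f : R -> R -> R) : smooth b f ->
  jet2 b (d_th f) (d_th (d_t f)) (d_th (d_th f))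
    (d_th (d_t (d_t f))) (d_th (d_th (d_t f))) (d_th (d_th (d_th f))).
Proof.
  intros Hf; pose proof (smooth_d_t b f Hf) as Ht; pose proof (smooth_d_th b f Hf) as Hh.
  pose proof (smooth_d_t b _ Ht) as Htt; pose proof (smooth_d_th b _ Ht) as Hth.
  pose proof (smooth_d_th b _ Hh) as Hhh.
  split; intros t th Hb.
  - apply (smooth_is_derive_th_t b); assumption.
  - apply (smooth_is_derive_th b); assumption.
  - apply (smooth_is_derive_th_t b); assumption.
  - apply (smooth_is_derive_th b); assumption.
  - replace (d_th (d_th (d_t f)) t th) with (d_th (d_t (d_th f)) t th).
    + apply (smooth_is_derive_th_t b); assumption.
    + apply Derive_ext; intros s; apply (smooth_schwarz b); assumption.
  - apply (smooth_is_derive_th b); assumption.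
  - apply (smooth_continuous b); assumption.
  - apply (smooth_continuous b); assumption.
  - apply (smooth_continuous b); assumption.
  - apply (smooth_continuous b); [apply smooth_d_th|]; assumption.
  - apply (smooth_continuous b); [apply smooth_d_th|]; assumption.
  - apply (smooth_continuous b); [apply smooth_d_th|]; assumption.
Qed.

Lemma harm_d_t (T b : R) (f : R -> R -> R) :
  0 < T < b -> smooth b f -> harm T f -> harm T (d_t f).
Proof.
  intros HT Hf Hh t th Ht.
  pose proof (smooth_d_t b _ (smooth_d_t b f Hf)) as Htt.
  assert (D : is_derive (fun s => d_t (d_t f) s th + d_th (d_th f) s th) t
      (d_t (d_t (d_t f)) t th + d_th (d_th (d_t f)) t th)).
  { apply (is_derive_plus (fun s => d_t (d_t f) s th) (fun s => d_th (d_th f) s th)).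
    - apply (smooth_is_derive_t b); [exact Htt | lra].
    - apply (jet_ht _ _ _ _ _ _ _ (jet2_d_th b f Hf)); lra. }
  rewrite <- (is_derive_unique _ _ _ D), (Derive_ext_loc _ (fun _ => 0)); [apply Derive_const|].
  eapply filter_imp; [|apply (locally_in_strip T t Ht)]; intros; apply Hh; assumption.
Qed.

Lemma jet2_mult (b : R) (f ft fh ftt fth fhh g gt gh gtt gth ghh : R -> R -> R) :
  jet2 b f ft fh ftt fth fhh -> jet2 b g gt gh gtt gth ghh ->
  jet2 b (fun t th => f t th * g t th)
    (fun t th => ft t th * g t th + f t th * gt t th)
    (fun t th => fh t th * g t th + f t th * gh t th)
    (fun t th => (ftt t th * g t th + ft t th * gt t th) + (ft t th * gt t th + f t th * gtt t th))
    (fun t th => (fth t th * g t th + ft t th * gh t th) + (fh t th * gt t th + f t th * gth t th))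
    (fun t th => (fhh t th * g t th + fh t th * gh t th) + (fh t th * gh t th + f t th * ghh t th)).
Proof.
  intros [A1 A2 A3 A4 A5 A6 A7 A8 A9 A10 A11 A12] [B1 B2 B3 B4 B5 B6 B7 B8 B9 B10 B11 B12].
  split; intros t th Ht.
  1, 2: apply (is_derive_mult_R (fun s => _) (fun s => _)); auto.
  5-10: repeat first [apply continuity_2d_pt_plus | apply continuity_2d_pt_mult]; auto.
  - apply (is_derive_plus (fun s => ft s th * g s th) (fun s => f s th * gt s th));
      apply (is_derive_mult_R (fun s => _) (fun s => _)); auto.
  - apply (is_derive_plus (fun s => ft t s * g t s) (fun s => f t s * gt t s));
      apply (is_derive_mult_R (fun s => _) (fun s => _)); auto.
  - replace (fth t th * g t th + ft t th * gh t th + (fh t th * gt t th + f t th * gth t th))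
      with ((fth t th * g t th + fh t th * gt t th) + (ft t th * gh t th + f t th * gth t th)) by ring.
    apply (is_derive_plus (fun s => fh s th * g s th) (fun s => f s th * gh s th));
      apply (is_derive_mult_R (fun s => _) (fun s => _)); auto.
  - apply (is_derive_plus (fun s => fh t s * g t s) (fun s => f t s * gh t s));
      apply (is_derive_mult_R (fun s => _) (fun s => _)); auto.
Qed.

Lemma jet2_linear (b u v : R) (f ft fh ftt fth fhh g gt gh gtt gth ghh : R -> R -> R) :
  jet2 b f ft fh ftt fth fhh -> jet2 b g gt gh gtt gth ghh ->
  jet2 b (fun t th => u * f t th + v * g t th) (fun t th => u * ft t th + v * gt t th)
    (fun t th => u * fh t th + v * gh t th) (fun t th => u * ftt t th + v * gtt t th)
    (fun t th => u * fth t th + v * gth t th) (fun t th => u * fhh t th + v * ghh t th).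
Proof.
  intros [A1 A2 A3 A4 A5 A6 A7 A8 A9 A10 A11 A12] [B1 B2 B3 B4 B5 B6 B7 B8 B9 B10 B11 B12].
  split; intros t th Ht.
  7-12: repeat first [apply continuity_2d_pt_plus | apply continuity_2d_pt_mult | apply continuity_2d_pt_const]; auto.
  all: apply (is_derive_plus (fun s => u * _) (fun s => v * _));
    apply (is_derive_scal (fun s => _)); auto.
Qed.

Lemma jet2_sep (b : R) (k k1 k2 a a1 a2 : R -> R) :
  (forall t, is_derive k t (k1 t)) -> (forall t, is_derive k1 t (k2 t)) -> (forall t, continuity_pt k2 t) ->
  (forall t, is_derive a t (a1 t)) -> (forall t, is_derive a1 t (a2 t)) -> (forall t, continuity_pt a2 t) ->
  jet2 b (fun t th => k t * a th) (fun t th => k1 t * a th) (fun t th => k t * a1 th)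
    (fun t th => k2 t * a th) (fun t th => k1 t * a1 th) (fun t th => k t * a2 th).
Proof.
  intros K1 K2 K3 A1 A2 A3.
  assert (D : forall (f f' : R -> R), (forall t, is_derive f t (f' t)) -> forall t, continuity_pt f t).
  { intros f f' H t; apply derivable_continuous_pt; eexists; apply is_derive_Reals, H. }
  pose proof (D k k1 K1); pose proof (D k1 k2 K2); pose proof (D a a1 A1); pose proof (D a1 a2 A2).
  assert (C : forall f h : R -> R, (forall t, continuity_pt f t) -> (forall t, continuity_pt h t) ->
    forall t th, continuity_2d_pt (fun t th => f t * h th) t th).
  { intros f h Hf Hh t th; apply continuity_2d_pt_mult.
    - apply (continuity_1d_2d_pt_comp f (fun t _ => t)); [apply Hf | apply continuity_2d_pt_id1].
    - apply (continuity_1d_2d_pt_comp h (fun _ th => th)); [apply Hh | apply continuity_2d_pt_id2]. }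
  assert (L : forall (f f' : R -> R) y, (forall t, is_derive f t (f' t)) ->
    forall t, is_derive (fun s => f s * y) t (f' t * y)).
  { intros f f' y Hf t; apply (is_derive_ext (fun s => y * f s)); [intros; apply Rmult_comm|].
    rewrite Rmult_comm; apply is_derive_scal, Hf. }
  split; intros t th _.
  - apply (L k k1 (a th) K1).
  - apply is_derive_scal, A1.
  - apply (L k1 k2 (a th) K2).
  - apply is_derive_scal, A1.
  - apply (L k k1 (a1 th) K1).
  - apply is_derive_scal, A2.
  - apply (C k a); assumption.
  - apply (C k1 a); assumption.
  - apply (C k a1); assumption.
  - apply (C k2 a); assumption.
  - apply (C k1 a1); assumption.
  - apply (C k a2); assumption.
Qed.

(** [u_t u_th] is, up to a factor, the imaginary part of [(u_t - i u_th)^2],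
    which is holomorphic in [t + i th]. *)
Lemma hopf_jet2 (T b : R) (u : R -> R -> R) : 0 < T < b -> smooth b u -> harm T u ->
  exists qh qtt qth qhh,
    jet2 b (fun t th => d_t u t th * d_th u t th)
      (fun t th => d_t (d_t u) t th * d_th u t th + d_t u t th * d_th (d_t u) t th) qh qtt qth qhh /\
    (forall t th, - T < t < T -> qtt t th + qhh t th = 0).
Proof.
  intros HT Hu Hh.
  do 4 eexists; split.
  - apply jet2_mult; [apply (smooth_jet2 b (d_t u)), smooth_d_t, Hu | apply (jet2_d_th b u Hu)].
  - intros t th Ht; simpl.
    (* Besides the Laplacians of the factors, the Laplacian of the product contains the cross term
       [2 (u_tt u_tth + u_tth u_thth)], which cancels because [u_thth = - u_tt]. *)
    assert (E1 : d_th (d_th u) t th = - d_t (d_t u) t th) by (specialize (Hh t th Ht); lra).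
    assert (E2 : d_th (d_th (d_t u)) t th = - d_t (d_t (d_t u)) t th)
      by (pose proof (harm_d_t T b u HT Hu Hh t th Ht); lra).
    assert (E3 : d_th (d_th (d_th u)) t th = - d_th (d_t (d_t u)) t th).
    { unfold d_th at 1; rewrite (Derive_ext _ (fun s => - d_t (d_t u) t s)).
      - rewrite Derive_opp; reflexivity.
      - intros s; specialize (Hh t s Ht); lra. }
    rewrite E1, E2, E3; ring.
Qed.

(** * The Hopf differential of a free boundary harmonic map *)

Lemma periodic_d_t (T b : R) (f : R -> R -> R) : 0 < T < b -> smooth b f ->
  (forall t th, - T <= t <= T -> f t (th + 2 * PI) = f t th) ->
  forall t th, - T <= t <= T -> d_t f t (th + 2 * PI) = d_t f t th.
Proof.
  intros HT Hf Hp t th Ht; apply Rminus_diag_uniq.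
  apply (continuity_closure (fun s => d_t f s (th + 2 * PI) - d_t f s th) T t); [lra | | | exact Ht].
  - intros s Hs; apply Rminus_diag_eq, Derive_ext_loc.
    eapply filter_imp; [|apply (locally_in_strip T s Hs)]; intros; apply Hp; lra.
  - apply continuity_pt_minus; apply continuity_2d_pt_t, (smooth_continuous b);
      try (apply smooth_d_t, Hf); lra.
Qed.

Lemma periodic_d_th (T b : R) (f : R -> R -> R) : 0 < T < b -> smooth b f ->
  (forall t th, - T <= t <= T -> f t (th + 2 * PI) = f t th) ->
  forall t th, - T <= t <= T -> d_th f t (th + 2 * PI) = d_th f t th.
Proof.
  intros HT Hf Hp; apply (jet2_h_periodic T b f _ _ _ _ _ (proj2 HT) (smooth_jet2 b f Hf) Hp).
Qed.

(** The geometric hypotheses as equations in the isothermal coordinate. The factor [t] in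
    [fb_outward] encodes the outward direction on both components at once, and makes the record
    invariant under [t -> - t]. *)
Record fb_annulus (T b : R) (X : R -> R -> vec3) : Prop := {
  fb_T : 0 < T < b;
  fb_smooth : smooth3 b X;
  fb_per : forall t th, - T <= t <= T -> X t (th + 2 * PI) = X t th;
  fb_conf : forall t th, - T <= t <= T ->
    dot3 (D_t X t th) (D_t X t th) = dot3 (D_th X t th) (D_th X t th);
  fb_harm : forall t th c, - T <= t <= T -> coord c ->
    c (D_t (D_t X) t th) + c (D_th (D_th X) t th) = 0;
  fb_sphere : forall t th, on_boundary T t -> dot3 (X t th) (X t th) = 1;
  fb_normal : forall t th, on_boundary T t ->
    D_t X t th = scal3 (dot3 (X t th) (D_t X t th)) (X t th);
  fb_outward : forall t th, on_boundary T t -> 0 < t * dot3 (X t th) (D_t X t th) }.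

Section FreeBoundary.
Variables (T b : R) (X : R -> R -> vec3).
Hypothesis HX : fb_annulus T b X.

Let HT : 0 < T < b := fb_T T b X HX.
Let HS : smooth3 b X := fb_smooth T b X HX.

Lemma boundary_in (t : R) : on_boundary T t -> - T <= t <= T /\ - b < t < b.
Proof. intros [-> | ->]; lra. Qed.

Lemma boundary_orth (t th : R) : on_boundary T t -> dot3 (X t th) (D_th X t th) = 0.
Proof.
  intros Ht; pose proof (smooth3_is_derive_th b X t th HS (proj2 (boundary_in t Ht))) as D.
  pose proof (derive_eq_const _ 1 th _ (fun s => fb_sphere T b X HX t s Ht) (is_derive_dot3 _ _ _ _ _ D D)) as E.
  rewrite (dot3_comm (D_th X t th)) in E; lra.
Qed.

Lemma boundary_speed (t th : R) : on_boundary T t ->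
  dot3 (D_t X t th) (D_t X t th) = dot3 (X t th) (D_t X t th) * dot3 (X t th) (D_t X t th).
Proof.
  intros Ht; rewrite (fb_normal T b X HX t th Ht) at 1.
  rewrite dot3_scal_l; reflexivity.
Qed.

(** Here [X_tt = - X_thth], and differentiating [X_t = m X] along the boundary gives
    [X_tth = m' X + m X_th]. Since [X . X_thth = - m^2] and [X_th . X_thth = m m'], the two
    contributions to the product cancel. *)
Lemma hopf_boundary (t th : R) : on_boundary T t ->
  dot3 (D_t (D_t X) t th) (D_th (D_t X) t th) = 0.
Proof.
  intros Ht; destruct (boundary_in t Ht) as [Ht1 Ht2].
  pose proof (smooth3_D_t b X HS) as HSt; pose proof (smooth3_D_th b X HS) as HSh.
  pose proof (smooth3_is_derive_th b X t th HS Ht2) as D.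
  pose proof (smooth3_is_derive_th b _ t th HSt Ht2) as Dt.
  pose proof (smooth3_is_derive_th b _ t th HSh Ht2) as Dh.
  set (m := fun s => dot3 (X t s) (D_t X t s)).
  pose proof (is_derive_dot3 _ _ _ _ _ D Dt) as Dm; fold m in Dm.
  set (dm := dot3 (D_th X t th) (D_t X t th) + dot3 (X t th) (D_th (D_t X) t th)) in Dm.
  assert (E1 : dot3 (X t th) (D_th (D_th X) t th) = - (m th * m th)).
  { pose proof (derive_eq_const _ 0 th _ (fun s => boundary_orth t s Ht) (is_derive_dot3 _ _ _ _ _ D Dh)) as E.
    cbv beta in E; rewrite <- (fb_conf T b X HX t th Ht1), (boundary_speed t th Ht) in E; unfold m; lra. }
  assert (E2 : dot3 (D_th X t th) (D_th (D_th X) t th) = m th * dm).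
  { assert (E : dot3 (D_th (D_th X) t th) (D_th X t th) + dot3 (D_th X t th) (D_th (D_th X) t th)
      = dm * m th + m th * dm).
    { apply (derive_eq (fun s => dot3 (D_th X t s) (D_th X t s)) (fun s => m s * m s) th).
      - intros s; rewrite <- (fb_conf T b X HX t s Ht1); apply boundary_speed, Ht.
      - apply (is_derive_dot3 _ _ _ _ _ Dh Dh).
      - apply (is_derive_mult_R m m); exact Dm. }
    rewrite (dot3_comm (D_th (D_th X) t th)) in E; lra. }
  assert (E3 : D_th (D_t X) t th = add3 (scal3 dm (X t th)) (scal3 (m th) (D_th X t th))).
  { apply (is_derive3_unique (fun s => D_t X t s) (fun s => scal3 (m s) (X t s)) th).
    - intros s; apply (fb_normal T b X HX t s Ht).
    - exact Dt.
    - apply is_derive3_scal; assumption. }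
  assert (E4 : D_t (D_t X) t th = scal3 (-1) (D_th (D_th X) t th)).
  { apply coord_ext; intros c Hc; rewrite coord_scal3 by exact Hc.
    pose proof (fb_harm T b X HX t th c Ht1 Hc); lra. }
  rewrite E4, E3, dot3_scal_l, dot3_add_r, !dot3_scal_r,
    (dot3_comm _ (X t th)), (dot3_comm _ (D_th X t th)), E1, E2; ring.
Qed.

Lemma harm_comp (c : vec3 -> R) : coord c -> harm T (comp3 c X).
Proof.
  intros Hc t th Ht; pose proof (fb_harm T b X HX t th c ltac:(lra) Hc) as H.
  change (comp3 c (D_t (D_t X)) t th + comp3 c (D_th (D_th X)) t th = 0) in H.
  rewrite !comp3_D_t, !comp3_D_th in H by exact Hc; exact H.
Qed.

Lemma per_comp (c : vec3 -> R) (t th : R) : coord c -> - T <= t <= T ->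
  comp3 c X t (th + 2 * PI) = comp3 c X t th.
Proof. intros Hc Ht; unfold comp3; rewrite (fb_per T b X HX t th Ht); reflexivity. Qed.

(** The imaginary part of the holomorphic function [X_zz . X_zz] vanishes on
    the boundary, hence everywhere; what is used of this is its [t]-derivative. *)
Lemma hopf_derivative (t th : R) : - T <= t <= T ->
  dot3 (D_t (D_t (D_t X)) t th) (D_th (D_t X) t th)
  + dot3 (D_t (D_t X) t th) (D_th (D_t (D_t X)) t th) = 0.
Proof.
  set (u := fun c => d_t (comp3 c X)).
  assert (Hu : forall c, coord c -> smooth b (u c)) by (intros c Hc; apply smooth_d_t, HS, Hc).
  assert (Hh : forall c, coord c -> harm T (u c))
    by (intros c Hc; apply (harm_d_t T b); [exact HT | apply HS, Hc | apply harm_comp, Hc]).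
  assert (Cx : coord vx) by (unfold coord; auto).
  assert (Cy : coord vy) by (unfold coord; auto).
  assert (Cz : coord vz) by (unfold coord; auto).
  assert (U : forall c s v, coord c ->
    d_t (u c) s v = c (D_t (D_t X) s v) /\ d_th (u c) s v = c (D_th (D_t X) s v) /\
    d_t (d_t (u c)) s v = c (D_t (D_t (D_t X)) s v) /\
    d_th (d_t (u c)) s v = c (D_th (D_t (D_t X)) s v))
    by (intros c s v [-> | [-> | ->]]; repeat split).
  destruct (hopf_jet2 T b (u vx) HT (Hu _ Cx) (Hh _ Cx)) as (xh & xtt & xth & xhh & Jx & Ex).
  destruct (hopf_jet2 T b (u vy) HT (Hu _ Cy) (Hh _ Cy)) as (yh & ytt & yth & yhh & Jy & Ey).
  destruct (hopf_jet2 T b (u vz) HT (Hu _ Cz) (Hh _ Cz)) as (zh & ztt & zth & zhh & Jz & Ez).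
  pose proof (jet2_linear b 1 1 _ _ _ _ _ _ _ _ _ _ _ _ (jet2_linear b 1 1 _ _ _ _ _ _ _ _ _ _ _ _ Jx Jy) Jz) as J.
  (* The sum over coordinates keeps the coefficients 1 produced by two uses of [jet2_linear], so
     that it matches [J]. Dirichlet uniqueness then applies to it. *)
  assert (Q0 : forall s v, - T <= s <= T -> 1 * (1 * (d_t (u vx) s v * d_th (u vx) s v)
      + 1 * (d_t (u vy) s v * d_th (u vy) s v)) + 1 * (d_t (u vz) s v * d_th (u vz) s v) = 0).
  { assert (QB : forall s v, on_boundary T s -> 1 * (1 * (d_t (u vx) s v * d_th (u vx) s v)
      + 1 * (d_t (u vy) s v * d_th (u vy) s v)) + 1 * (d_t (u vz) s v * d_th (u vz) s v) = 0).
    { intros s v Hs; rewrite <- (hopf_boundary s v Hs).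
      destruct (U vx s v Cx) as (-> & -> & _), (U vy s v Cy) as (-> & -> & _), (U vz s v Cz) as (-> & -> & _).
      unfold dot3; ring. }
    intros s v; revert s v; eapply (harmonic_dirichlet T b); [lra | lra | exact J | | | |].
    - intros s v Hs.
      assert (P : forall c, coord c -> d_t (u c) s (v + 2 * PI) = d_t (u c) s v /\
        d_th (u c) s (v + 2 * PI) = d_th (u c) s v).
      { intros c Hc.
        assert (Pu : forall s v, - T <= s <= T -> u c s (v + 2 * PI) = u c s v).
        { apply (periodic_d_t T b); [exact HT | apply HS, Hc | intros; apply per_comp; assumption]. }
        split; [apply (periodic_d_t T b) | apply (periodic_d_th T b)]; auto. }
      destruct (P _ Cx) as [-> ->], (P _ Cy) as [-> ->], (P _ Cz) as [-> ->]; reflexivity.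
    - intros s v Hs; specialize (Ex s v Hs); specialize (Ey s v Hs); specialize (Ez s v Hs); lra.
    - intros v; apply QB; left; reflexivity.
    - intros v; apply QB; right; reflexivity. }
  intros Ht; pose proof (jet2_vanish_t T b _ _ _ _ _ _ (proj1 HT) (proj2 HT) J Q0 t th Ht) as E.
  cbv beta in E; rewrite <- E.
  destruct (U vx t th Cx) as (-> & -> & -> & ->), (U vy t th Cy) as (-> & -> & -> & ->),
    (U vz t th Cz) as (-> & -> & -> & ->).
  unfold dot3; ring.
Qed.

(** Cauchy-Riemann for [X_zz . X_zz]: the [th]-derivative of the real part is, up to a factor, the
    [t]-derivative of the imaginary part, computed in [hopf_derivative]. This is done for interior
    [t], then transported to [T] by continuity. *)
Lemma hopf_const (th th' : R) :
  dot3 (D_t (D_t X) T th) (D_t (D_t X) T th) - dot3 (D_th (D_t X) T th) (D_th (D_t X) T th) =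
  dot3 (D_t (D_t X) T th') (D_t (D_t X) T th') - dot3 (D_th (D_t X) T th') (D_th (D_t X) T th').
Proof.
  pose proof (smooth3_D_t b X HS) as HSt.
  pose proof (smooth3_D_t b _ HSt) as HStt; pose proof (smooth3_D_th b _ HSt) as HSth.
  set (p := fun t th => dot3 (D_t (D_t X) t th) (D_t (D_t X) t th)
    - dot3 (D_th (D_t X) t th) (D_th (D_t X) t th)).
  change (p T th = p T th'); apply Rminus_diag_uniq.
  assert (Hp : forall t v, - b < t < b -> continuity_2d_pt p t v).
  { intros; apply continuity_2d_pt_minus; apply (dot3_continuous b); assumption. }
  apply (continuity_closure (fun t => p t th - p t th') T T); [lra | | | lra].
  2: apply continuity_pt_minus; apply continuity_2d_pt_t, Hp; lra.
  intros t Ht; apply Rminus_diag_eq.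
  apply (derive_eq_const_conv (p t) (fun v =>
    (dot3 (D_th (D_t (D_t X)) t v) (D_t (D_t X) t v) + dot3 (D_t (D_t X) t v) (D_th (D_t (D_t X)) t v))
    - (dot3 (D_th (D_th (D_t X)) t v) (D_th (D_t X) t v) + dot3 (D_th (D_t X) t v) (D_th (D_th (D_t X)) t v)))).
  - intros v.
    pose proof (smooth3_is_derive_th b _ t v HStt ltac:(lra)) as D1.
    pose proof (smooth3_is_derive_th b _ t v HSth ltac:(lra)) as D2.
    apply (is_derive_minus (fun v => dot3 (D_t (D_t X) t v) (D_t (D_t X) t v))
      (fun v => dot3 (D_th (D_t X) t v) (D_th (D_t X) t v))); apply is_derive_dot3; assumption.
  - intros v.
    assert (E : D_th (D_th (D_t X)) t v = scal3 (-1) (D_t (D_t (D_t X)) t v)).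
    { apply coord_ext; intros c Hc; rewrite coord_scal3 by exact Hc.
      pose proof (harm_d_t T b _ HT (HS c Hc) (harm_comp c Hc) t v Ht) as H.
      rewrite <- !comp3_D_t, <- !comp3_D_th in H by exact Hc; unfold comp3 in H; lra. }
    rewrite E, dot3_scal_l, dot3_scal_r, (dot3_comm (D_th (D_t X) t v)), (dot3_comm (D_th (D_t (D_t X)) t v)).
    pose proof (hopf_derivative t v ltac:(lra)); lra.
Qed.
End FreeBoundary.

(** * The boundary circle and its harmonic extension *)

Section Curve.
Variables (g g1 g2 g3 : R -> vec3) (l k : R).
Hypothesis Hl : 0 < l.
Hypothesis D0 : forall s, is_derive3 g s (g1 s).
Hypothesis D1 : forall s, is_derive3 g1 s (g2 s).
Hypothesis D2 : forall s, is_derive3 g2 s (g3 s).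
Hypothesis H00 : forall s, dot3 (g s) (g s) = 1.
Hypothesis H11 : forall s, dot3 (g1 s) (g1 s) = l * l.
Hypothesis H22 : forall s, dot3 (g2 s) (g2 s) = k.

Lemma curve_01 (s : R) : dot3 (g s) (g1 s) = 0.
Proof.
  pose proof (derive_eq_const _ _ _ _ H00 (is_derive_dot3 _ _ _ _ _ (D0 s) (D0 s))) as E.
  rewrite (dot3_comm (g1 s)) in E; lra.
Qed.

Lemma curve_12 (s : R) : dot3 (g1 s) (g2 s) = 0.
Proof.
  pose proof (derive_eq_const _ _ _ _ H11 (is_derive_dot3 _ _ _ _ _ (D1 s) (D1 s))) as E.
  rewrite (dot3_comm (g2 s)) in E; lra.
Qed.

Lemma curve_02 (s : R) : dot3 (g s) (g2 s) = - (l * l).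
Proof.
  pose proof (derive_eq_const _ _ _ _ curve_01 (is_derive_dot3 _ _ _ _ _ (D0 s) (D1 s))) as E.
  pose proof (H11 s); lra.
Qed.

(** The Gram determinant of [g], [g'], [g''] is [l^2 (k - l^4)], and it is a square. *)
Lemma curve_accel_ge : l * l * (l * l) <= k.
Proof.
  pose proof (triple_sqr (g 0) (g1 0) (g2 0)) as E.
  rewrite H00, H11, H22, curve_01, curve_12, curve_02 in E.
  pose proof (pow2_ge_0 (dot3 (g2 0) (cross3 (g 0) (g1 0)))).
  assert (0 < l * l) by nra.
  apply Rnot_lt_le; intros H'; nra.
Qed.

(** [g, g', g''] span R^3 unless [g] is a great circle, where [k = l^4]. *)
Lemma curve_third (s : R) : g3 s = scal3 (- (k / (l * l))) (g1 s).
Proof.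
  assert (Hl2 : 0 < l * l) by nra.
  destruct (Req_dec k (l * l * (l * l))) as [Hk|Hk].
  (* Great circle: [|g'' + l^2 g|^2 = k - l^4 = 0]. *)
  - assert (E : forall v, g2 v = scal3 (- (l * l)) (g v)).
    { intros v; assert (Z : add3 (g2 v) (scal3 (l * l) (g v)) = (0, 0, 0)).
      { apply dot3_pos.
        rewrite dot3_add_l, !dot3_add_r, !dot3_scal_l, !dot3_scal_r, (dot3_comm (g2 v) (g v)), H22, H00, curve_02, Hk.
        ring. }
      apply coord_ext; intros c Hc; apply (f_equal c) in Z.
      rewrite coord_add3, coord_scal3 in Z by exact Hc; rewrite coord_scal3 by exact Hc.
      destruct Hc as [-> | [-> | ->]]; vec; lra. }
    replace (- (k / (l * l))) with (- (l * l)) by (rewrite Hk; field; lra).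
    apply (is_derive3_unique g2 (fun v => scal3 (- (l * l)) (g v)) s _ _ E (D2 s)).
    intros c Hc; rewrite coord_scal3 by exact Hc.
    apply (is_derive_ext (fun v => - (l * l) * c (g v))).
    + intros v; symmetry; apply coord_scal3, Hc.
    + apply is_derive_scal, D0, Hc.
  (* The derivatives of the constant products [g . g''], [g' . g''] and [g'' . g''] give the
     components of [g'''] along [g], [g'] and [g'']. *)
  - assert (Z : add3 (g3 s) (scal3 (k / (l * l)) (g1 s)) = (0, 0, 0)).
    { pose proof (derive_eq_const _ _ _ _ curve_02 (is_derive_dot3 _ _ _ _ _ (D0 s) (D2 s))) as E1.
      pose proof (derive_eq_const _ _ _ _ curve_12 (is_derive_dot3 _ _ _ _ _ (D1 s) (D2 s))) as E2.
      pose proof (derive_eq_const _ _ _ _ H22 (is_derive_dot3 _ _ _ _ _ (D2 s) (D2 s))) as E3.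
      cbv beta in E1, E2, E3.
      pose proof (curve_12 s) as F; pose proof (curve_01 s) as F1; rewrite dot3_comm in F1.
      rewrite H22 in E2; rewrite (dot3_comm _ (g3 s)) in E1; rewrite (dot3_comm _ (g3 s)) in E2;
        rewrite (dot3_comm (g2 s)) in E3.
      apply (orthogonal_to_basis (g s) (g1 s) (g2 s)).
      - intros E; pose proof (triple_sqr (g s) (g1 s) (g2 s)) as E4.
        rewrite E, H00, H11, H22, curve_01, curve_12, curve_02 in E4.
        apply Hk; apply (Rmult_eq_reg_l (l * l)); lra.
      - rewrite dot3_add_l, dot3_scal_l, F1; lra.
      - rewrite dot3_add_l, dot3_scal_l, H11.
        replace (dot3 (g3 s) (g1 s)) with (- k) by lra; field; lra.
      - rewrite dot3_add_l, dot3_scal_l, F; lra. }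
    apply coord_ext; intros c Hc; apply (f_equal c) in Z.
    rewrite coord_add3, coord_scal3 in Z by exact Hc; rewrite coord_scal3 by exact Hc.
    destruct Hc as [-> | [-> | ->]]; vec; lra.
Qed.
End Curve.

(** * The explicit solution of the Cauchy problem *)

Lemma is_derive_cosh (t : R) : is_derive cosh t (sinh t).
Proof. apply is_derive_Reals, derivable_pt_lim_cosh. Qed.

Lemma is_derive_sinh (t : R) : is_derive sinh t (cosh t).
Proof. apply is_derive_Reals, derivable_pt_lim_sinh. Qed.

(** The solution of [P'' = w^2 P] with [P(T) = 1] and [P'(T) = l]: the radial factor of a separated
    harmonic function of angular frequency [w]. *)
Definition profile (T l w t : R) : R := cosh (w * (t - T)) + l / w * sinh (w * (t - T)).
Definition profile' (T l w t : R) : R := w * sinh (w * (t - T)) + l * cosh (w * (t - T)).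

Lemma is_derive_profile (T l w t : R) : w <> 0 ->
  is_derive (profile T l w) t (profile' T l w t) /\
  is_derive (profile' T l w) t (w * w * profile T l w t).
Proof.
  intros Hw.
  assert (Ha : is_derive (fun t => w * (t - T)) t w) by (auto_derive; [exact I | ring]).
  pose proof (is_derive_comp cosh (fun t => w * (t - T)) t _ _ (is_derive_cosh _) Ha) as Dc.
  pose proof (is_derive_comp sinh (fun t => w * (t - T)) t _ _ (is_derive_sinh _) Ha) as Ds.
  unfold scal in Dc, Ds; simpl in Dc, Ds; unfold mult in Dc, Ds; simpl in Dc, Ds.
  unfold profile, profile'; split.
  - replace (w * sinh (w * (t - T)) + l * cosh (w * (t - T)))
      with (w * sinh (w * (t - T)) + l / w * (w * cosh (w * (t - T)))) by (field; exact Hw).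
    apply (is_derive_plus (fun t => cosh (w * (t - T))) (fun t => l / w * sinh (w * (t - T))));
      [exact Dc | apply is_derive_scal, Ds].
  - replace (w * w * (cosh (w * (t - T)) + l / w * sinh (w * (t - T))))
      with (w * (w * cosh (w * (t - T))) + l * (w * sinh (w * (t - T)))) by (field; exact Hw).
    apply (is_derive_plus (fun t => w * sinh (w * (t - T))) (fun t => l * cosh (w * (t - T))));
      apply is_derive_scal; assumption.
Qed.

(** On [t = T], [f] splits into the constant [c], which extends affinely in [t], and [f - c], an
    eigenfunction of the second [th]-derivative, which extends by [profile]. The difference from [f]
    is harmonic with zero Cauchy data. The first derivatives are recorded for the free boundary
    condition at [- T]. *)
Lemma cauchy_extension (T b l w c : R) (f : R -> R -> R) :
  0 < T < b -> 0 < w -> smooth b f -> harm T f ->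
  (forall t th, - T <= t <= T -> f t (th + 2 * PI) = f t th) ->
  (forall th, d_t f T th = l * f T th) ->
  (forall th, d_th (d_th f) T th = - (w * w) * (f T th - c)) ->
  forall t th, - T <= t <= T ->
    f t th = c * (1 + l * (t - T)) + (f T th - c) * profile T l w t /\
    d_t f t th = c * l + (f T th - c) * profile' T l w t /\
    d_th f t th = d_th f T th * profile T l w t.
Proof.
  intros HT Hw Hf Hh Hp H1 H2.
  assert (Hw0 : w <> 0) by lra.
  assert (HTb : - b < T < b) by lra.
  pose proof (smooth_jet2 b f Hf) as Jf.
  pose proof (fun t => proj1 (is_derive_profile T l w t Hw0)) as P1.
  pose proof (fun t => proj2 (is_derive_profile T l w t Hw0)) as P2.
  assert (Jl : jet2 b (fun t _ => (c * (1 + l * (t - T))) * 1) (fun _ _ => c * l * 1)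
    (fun t _ => c * (1 + l * (t - T)) * 0) (fun _ _ => 0 * 1) (fun _ _ => c * l * 0)
    (fun t _ => c * (1 + l * (t - T)) * 0)).
  { apply (jet2_sep b (fun t => c * (1 + l * (t - T))) (fun _ => c * l) (fun _ => 0)
      (fun _ => 1) (fun _ => 0) (fun _ => 0)); intros t.
    - auto_derive; [exact I | ring].
    - apply (is_derive_const (c * l) t).
    - apply continuity_pt_const; intros ? ?; reflexivity.
    - apply (is_derive_const 1 t).
    - apply (is_derive_const 0 t).
    - apply continuity_pt_const; intros ? ?; reflexivity. }
  assert (Jg : jet2 b (fun t th => profile T l w t * (f T th - c)) (fun t th => profile' T l w t * (f T th - c))
    (fun t th => profile T l w t * d_th f T th) (fun t th => w * w * profile T l w t * (f T th - c))
    (fun t th => profile' T l w t * d_th f T th) (fun t th => profile T l w t * d_th (d_th f) T th)).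
  { apply (jet2_sep b (profile T l w) (profile' T l w) (fun t => w * w * profile T l w t)
      (fun th => f T th - c) (d_th f T) (d_th (d_th f) T)); intros t.
    - apply P1.
    - apply P2.
    - apply continuity_pt_mult; [apply continuity_pt_const; intros ? ?; reflexivity|].
      apply derivable_continuous_pt; eexists; apply is_derive_Reals, P1.
    - replace (d_th f T t) with (minus (d_th f T t) 0) by (unfold minus, plus, opp; simpl; ring).
      apply (is_derive_minus (f T) (fun _ => c)); [|apply (is_derive_const c t)].
      apply (smooth_is_derive_th b f Hf T t HTb).
    - apply (smooth_is_derive_th b _ (smooth_d_th b f Hf) T t HTb).
    - apply continuity_2d_pt_th, (smooth_continuous b); [|exact HTb].
      apply smooth_d_th, smooth_d_th, Hf. }
  pose proof (jet2_linear b 1 (-1) _ _ _ _ _ _ _ _ _ _ _ _ Jf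
    (jet2_linear b 1 1 _ _ _ _ _ _ _ _ _ _ _ _ Jl Jg)) as J.
  assert (PT : profile T l w T = 1 /\ profile' T l w T = l).
  { unfold profile, profile'; replace (w * (T - T)) with 0 by ring; rewrite cosh_0, sinh_0; lra. }
  assert (Z : forall t th, - T <= t <= T -> 1 * f t th + -1 * (1 * (c * (1 + l * (t - T)) * 1)
    + 1 * (profile T l w t * (f T th - c))) = 0).
  { apply (harmonic_cauchy T b _ _ _ _ _ _ (proj1 HT) (proj2 HT) J); cbv beta.
    - intros t th Ht; rewrite (Hp t th Ht), (Hp T th ltac:(lra)); reflexivity.
    - intros t th Ht; specialize (Hh t th Ht).
      replace (d_t (d_t f) t th) with (- d_th (d_th f) t th) by lra; rewrite H2; ring.
    - intros th; rewrite (proj1 PT); ring.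
    - intros th; rewrite (proj2 PT), H1; ring. }
  intros t th Ht.
  pose proof (jet2_vanish_t T b _ _ _ _ _ _ (proj1 HT) (proj2 HT) J Z t th Ht) as Zt.
  pose proof (jet2_vanish_h T b _ _ _ _ _ _ (proj2 HT) J Z t th Ht) as Zh.
  specialize (Z t th Ht); cbv beta in Zt, Zh; repeat split; lra.
Qed.

(** * Hyperbolic functions and the transcendental equations for the parameters *)

Lemma sinh_gt_id (y : R) : 0 < y -> y < sinh y.
Proof.
  intros Hy.
  destruct (mvt_open (fun x => sinh x - x) (fun x => cosh x - 1) 0 y Hy) as (s & Hs & E).
  - intros; apply derivable_continuous_pt; eexists; apply is_derive_Reals.
    apply (is_derive_minus sinh (fun x => x)); [apply is_derive_sinh | apply (is_derive_id t)].
  - intros; apply (is_derive_minus sinh (fun x => x)); [apply is_derive_sinh | apply (is_derive_id t)].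
  - rewrite sinh_0 in E.
    assert (1 < cosh s).
    { unfold cosh; pose proof (exp_pos s); pose proof (exp_ineq1 s ltac:(lra)).
      assert (exp s * exp (- s) = 1) by (rewrite <- exp_plus, Rplus_opp_r; apply exp_0).
      nra. }
    nra.
Qed.

Lemma cosh_gt_0 (x : R) : 0 < cosh x.
Proof. unfold cosh; pose proof (exp_pos x); pose proof (exp_pos (- x)); lra. Qed.

Lemma cosh_sqr (x : R) : cosh x * cosh x = 1 + sinh x * sinh x.
Proof.
  unfold cosh, sinh; assert (exp x * exp (- x) = 1) by (rewrite <- exp_plus, Rplus_opp_r; apply exp_0).
  lra.
Qed.

Lemma sinh_minus (x y : R) : sinh (x - y) = sinh x * cosh y - cosh x * sinh y.
Proof.
  unfold cosh, sinh; replace (- (x - y)) with (- x + y) by ring; replace (x - y) with (x + - y) by ring.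
  rewrite !exp_plus; field.
Qed.

Lemma cosh_minus (x y : R) : cosh (x - y) = cosh x * cosh y - sinh x * sinh y.
Proof.
  unfold cosh, sinh; replace (- (x - y)) with (- x + y) by ring; replace (x - y) with (x + - y) by ring.
  rewrite !exp_plus; field.
Qed.

Lemma sinh_double (x : R) : sinh (2 * x) = 2 * (sinh x * cosh x).
Proof.
  unfold cosh, sinh; replace (- (2 * x)) with (- x + - x) by ring; replace (2 * x) with (x + x) by ring.
  rewrite !exp_plus; field.
Qed.

Lemma cosh_double (x : R) : cosh (2 * x) = cosh x * cosh x + sinh x * sinh x.
Proof.
  unfold cosh, sinh; replace (- (2 * x)) with (- x + - x) by ring; replace (2 * x) with (x + x) by ring.
  rewrite !exp_plus; field.
Qed.

(** The factor [tanh] increases because [sinh (y - x) > 0] expands to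
    [sinh y cosh x > cosh y sinh x]. *)
Lemma x_tanh_x_lt (x y : R) : 0 < x < y -> x * tanh x < y * tanh y.
Proof.
  intros H; unfold tanh.
  assert (Hd : 0 < sinh (y - x)) by (pose proof (sinh_gt_id (y - x)); lra).
  assert (0 < sinh x) by (pose proof (sinh_gt_id x); lra).
  rewrite sinh_minus in Hd; pose proof (cosh_gt_0 x); pose proof (cosh_gt_0 y).
  assert (sinh x / cosh x < sinh y / cosh y).
  { apply (Rmult_lt_reg_r (cosh x * cosh y)); [nra|].
    replace (sinh x / cosh x * (cosh x * cosh y)) with (sinh x * cosh y) by (field; lra).
    replace (sinh y / cosh y * (cosh x * cosh y)) with (sinh y * cosh x) by (field; lra); lra. }
  assert (0 < sinh x / cosh x) by (apply Rdiv_lt_0_compat; assumption).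
  nra.
Qed.

Lemma x_tanh_x_inj (x y : R) : 0 < x -> 0 < y -> x * tanh x = y * tanh y -> x = y.
Proof.
  intros Hx Hy E; destruct (Rtotal_order x y) as [H|[H|H]]; [exfalso | exact H | exfalso];
    [pose proof (x_tanh_x_lt x y) | pose proof (x_tanh_x_lt y x)]; lra.
Qed.

(** In exponentials the profile is [((1 + r) e^x + (1 - r) e^(- x)) / 2] with [0 < r <= 1]. *)
Lemma profile_pos (T l w t : R) : 0 < w -> 0 < l <= w -> 0 < profile T l w t.
Proof.
  intros Hw Hl; unfold profile; set (x := w * (t - T)).
  assert (Hr : 0 < l / w <= 1).
  { split; [apply Rdiv_lt_0_compat; lra|].
    apply (Rmult_le_reg_r w); [exact Hw|]; unfold Rdiv; rewrite Rmult_assoc, Rinv_l; lra. }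
  pose proof (exp_pos x); pose proof (exp_pos (- x)).
  unfold cosh, sinh; nra.
Qed.

(** The second boundary component: besides the critical catenoid, the equations
    allow one more value [G] of the profile, for which [y = 2 w T] would solve
    [sinh y = y]. *)
Lemma critical_parameters (T l w m : R) :
  0 < l <= w -> 0 < T -> T * tanh T = 1 -> m < 0 ->
  let r := l / w in let cc := 1 - r * r in
  let G := profile T l w (- T) in let G' := profile' T l w (- T) in
  cc * (1 - 2 * l * T) * (1 - 2 * l * T) + r * r * (G * G) = 1 ->
  m * m = l * l * (G * G) ->
  l * cc = m * ((1 - 2 * l * T) * cc) ->
  G' = m * G ->
  w = 1 /\ l * T = 1.
Proof.
  intros Hl HT Hcrit Hm r cc G G' E1 E2 E3 E4.
  assert (Hw : 0 < w) by lra.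
  assert (Hr : 0 < r <= 1).
  { unfold r; split; [apply Rdiv_lt_0_compat; lra|].
    apply (Rmult_le_reg_r w); [exact Hw|]; unfold Rdiv; rewrite Rmult_assoc, Rinv_l; lra. }
  assert (HG : 0 < G) by (apply profile_pos; assumption).
  assert (Hlr : l = r * w) by (unfold r; field; lra).
  (* Of the two square roots of [E2], the sign of [m] selects the negative one. *)
  assert (HmG : m = - (l * G)).
  { assert ((m - l * G) * (m + l * G) = 0) by lra.
    assert (m - l * G < 0) by nra.
    assert (m + l * G = 0) by (apply (Rmult_eq_reg_l (m - l * G)); lra); lra. }
  set (a := w * T).
  assert (Ha : 0 < a) by (unfold a; nra).
  assert (EG : G = cosh (2 * a) - r * sinh (2 * a)).
  { unfold G, profile; replace (w * (- T - T)) with (0 - 2 * a) by (unfold a; ring).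
    rewrite cosh_minus, sinh_minus, cosh_0, sinh_0; fold r; ring. }
  assert (EG' : G' = w * (r * cosh (2 * a) - sinh (2 * a))).
  { unfold G', profile'; replace (w * (- T - T)) with (0 - 2 * a) by (unfold a; ring).
    rewrite cosh_minus, sinh_minus, cosh_0, sinh_0, Hlr; ring. }
  (* If [cc = 0] the boundary is a great circle and [G = exp (- 2 a) < 1], whereas [E1] would force
     [G = 1]. *)
  assert (Hcc : cc <> 0).
  { intros Z; assert (r = 1) by (unfold cc in Z; nra).
    rewrite Z, H in E1; assert (G = 1) by nra.
    rewrite H0, H in EG.
    assert (exp (- (2 * a)) < 1) by (rewrite <- exp_0; apply exp_increasing; lra).
    unfold cosh, sinh in EG; lra. }
  assert (E5 : G * (2 * l * T - 1) = 1).
  { apply (Rmult_eq_reg_l (l * cc)); [|apply Rmult_integral_contrapositive; split; lra].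
    rewrite HmG in E3; lra. }
  (* Multiplying the sphere equation [E1] by [G^2] and using [E5] leaves [cc + r^2 G^4 = G^2], which
     factors because [cc = 1 - r^2]. *)
  assert (E6 : (G * G - 1) * (r * r * (G * G) - cc) = 0).
  { assert (cc * (1 - 2 * l * T) * (1 - 2 * l * T) * (G * G) = cc).
    { replace (cc * (1 - 2 * l * T) * (1 - 2 * l * T) * (G * G))
        with (cc * (G * (2 * l * T - 1)) * (G * (2 * l * T - 1))) by ring.
      rewrite E5; ring. }
    assert (cc * (1 - 2 * l * T) * (1 - 2 * l * T) * (G * G) + r * r * (G * G) * (G * G) = G * G)
      by (apply (f_equal (Rmult (G * G))) in E1; lra).
    unfold cc in *; lra. }
  pose proof (cosh_sqr a) as Hca; pose proof (cosh_gt_0 a) as Hcp.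
  apply Rmult_integral in E6; destruct E6 as [E6|E6].
  - assert (HG1 : G = 1) by nra.
    rewrite HG1 in E5, EG.
    assert (HlT : l * T = 1) by lra.
    assert (Hs : 0 < sinh a) by (pose proof (sinh_gt_id a Ha); lra).
    (* [G = 1] reads [cosh (2 a) - 1 = r sinh (2 a)], that is [tanh a = r]; then
       [a tanh a = l T = 1 = T tanh T]. *)
    assert (Ht : sinh a = r * cosh a).
    { rewrite cosh_double, sinh_double in EG; apply (Rmult_eq_reg_l (2 * sinh a)); lra. }
    assert (Hat : a = T).
    { apply x_tanh_x_inj; [exact Ha | exact HT |].
      rewrite Hcrit; unfold tanh; rewrite Ht.
      replace (a * (r * cosh a / cosh a)) with (a * r) by (field; lra).
      unfold a; rewrite <- HlT, Hlr; ring. }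
    split; [|exact HlT].
    apply (Rmult_eq_reg_r T); [unfold a in Hat; lra | lra].
  - exfalso.
    assert (E7 : r * cosh (2 * a) - sinh (2 * a) = - (r * (G * G))).
    { apply (Rmult_eq_reg_l w); [|lra].
      rewrite <- EG', E4, HmG, Hlr; ring. }
    assert (E8 : cc * sinh (2 * a) = r * (G * G) + r * G).
    { unfold cc; rewrite EG at 3; lra. }
    (* Here [cc = r^2 G^2]; dividing [E8] by it gives [(1 + 1 / G) / r], and [E5] says that
       [2 l T = 1 + 1 / G]. *)
    assert (Hy : sinh (2 * a) = 2 * a).
    { apply (Rmult_eq_reg_l (r * r * (G * G))); [|apply Rgt_not_eq; nra].
      replace (r * r * (G * G)) with cc at 1 by lra; rewrite E8.
      unfold a; replace (r * r * (G * G) * (2 * (w * T))) with (r * G * (G * (2 * l * T - 1) + G))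
        by (rewrite Hlr; ring).
      rewrite E5; ring. }
    pose proof (sinh_gt_id (2 * a)); lra.
Qed.

(** * Rigidity *)

(** [E1] and [E2] rotate the pair [(a, a1)] back by the angle [s]; the rotated pair is constant. *)
Lemma circular_motion (a a1 : R -> R) :
  (forall s, is_derive a s (a1 s)) -> (forall s, is_derive a1 s (- a s)) ->
  forall s, a s = a 0 * cos s + a1 0 * sin s.
Proof.
  intros H H1 s.
  assert (E1 : a s * cos s - a1 s * sin s = a 0 * cos 0 - a1 0 * sin 0).
  { apply (derive_eq_const_conv (fun s => a s * cos s - a1 s * sin s)
      (fun s => (a1 s * cos s + a s * - sin s) - (- a s * sin s + a1 s * cos s))).
    - intros v; apply (is_derive_minus (fun s => a s * cos s) (fun s => a1 s * sin s));
        apply is_derive_mult_R; auto; [apply is_derive_cos | apply is_derive_sin].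
    - intros; ring. }
  assert (E2 : a s * sin s + a1 s * cos s = a 0 * sin 0 + a1 0 * cos 0).
  { apply (derive_eq_const_conv (fun s => a s * sin s + a1 s * cos s)
      (fun s => (a1 s * sin s + a s * cos s) + (- a s * cos s + a1 s * - sin s))).
    - intros v; apply (is_derive_plus (fun s => a s * sin s) (fun s => a1 s * cos s));
        apply is_derive_mult_R; auto; [apply is_derive_sin | apply is_derive_cos].
    - intros; ring. }
  rewrite cos_0, sin_0 in E1, E2.
  replace (a 0) with (a s * cos s - a1 s * sin s) by lra.
  replace (a1 0) with (a s * sin s + a1 s * cos s) by lra.
  pose proof (sin2_cos2 s) as E; unfold Rsqr in E.
  replace ((a s * cos s - a1 s * sin s) * cos s + (a s * sin s + a1 s * cos s) * sin s)
    with (a s * (sin s * sin s + cos s * cos s)) by ring.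
  rewrite E; ring.
Qed.

(** * Orthonormal frames as isometries of the ball *)

Section Frame.
Variables e1 e2 e3 : vec3.
Hypothesis H11 : dot3 e1 e1 = 1.
Hypothesis H22 : dot3 e2 e2 = 1.
Hypothesis H33 : dot3 e3 e3 = 1.
Hypothesis H12 : dot3 e1 e2 = 0.
Hypothesis H13 : dot3 e1 e3 = 0.
Hypothesis H23 : dot3 e2 e3 = 0.

Definition frame_coords (p : vec3) : vec3 := (dot3 p e1, dot3 p e2, dot3 p e3).

Lemma frame_expand (p : vec3) :
  p = add3 (scal3 (dot3 p e1) e1) (add3 (scal3 (dot3 p e2) e2) (scal3 (dot3 p e3) e3)).
Proof.
  set (q := add3 (scal3 (dot3 p e1) e1) (add3 (scal3 (dot3 p e2) e2) (scal3 (dot3 p e3) e3))).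
  assert (Z : add3 p (scal3 (-1) q) = (0, 0, 0)).
  { apply (orthogonal_to_basis e1 e2 e3).
    - intros E; pose proof (triple_sqr e1 e2 e3) as E'.
      rewrite E, H11, H22, H33, H12, H13, H23 in E'; lra.
    - unfold q; rewrite !dot3_add_l, !dot3_scal_l, !dot3_add_l, !dot3_scal_l, H11,
        (dot3_comm e2 e1), (dot3_comm e3 e1), H12, H13; ring.
    - unfold q; rewrite !dot3_add_l, !dot3_scal_l, !dot3_add_l, !dot3_scal_l, H22, H12,
        (dot3_comm e3 e2), H23; ring.
    - unfold q; rewrite !dot3_add_l, !dot3_scal_l, !dot3_add_l, !dot3_scal_l, H33, H13, H23; ring. }
  clearbody q; apply coord_ext; intros c Hc; apply (f_equal c) in Z.
  rewrite coord_add3, coord_scal3 in Z by exact Hc.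
  destruct Hc as [-> | [-> | ->]]; unfold vx, vy, vz in *; simpl in Z; lra.
Qed.

Lemma frame_coords_dot (p : vec3) : dot3 (frame_coords p) (frame_coords p) = dot3 p p.
Proof.
  rewrite (frame_expand p) at 4; rewrite !dot3_add_r, !dot3_scal_r.
  unfold frame_coords, dot3 at 1, vx at 1 2, vy at 1 2, vz at 1 2; simpl; ring.
Qed.

Lemma frame_coords_isometry : isometry3 frame_coords.
Proof.
  intros p q; unfold dist3, norm3; f_equal.
  rewrite <- (frame_coords_dot (add3 p (scal3 (-1) q))); f_equal;
    unfold frame_coords; apply vec3_ext; vec; ring.
Qed.

Lemma frame_coords_ball : same_set (image_of frame_coords unit_ball) unit_ball.
Proof.
  intros p; split.
  - intros (q & Hq & <-); unfold unit_ball, norm3 in *; rewrite frame_coords_dot; exact Hq.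
  - intros Hp.
    set (q := add3 (scal3 (vx p) e1) (add3 (scal3 (vy p) e2) (scal3 (vz p) e3))).
    assert (E : frame_coords q = p).
    { destruct p as [[x y] z]; unfold frame_coords, q, vx, vy, vz; simpl.
      rewrite !dot3_add_l, !dot3_scal_l, H11, H22, H33, (dot3_comm e2 e1), (dot3_comm e3 e1),
        (dot3_comm e3 e2), H12, H13, H23; repeat f_equal; ring. }
    exists q; split; [|exact E].
    unfold unit_ball, norm3 in *; rewrite <- frame_coords_dot, E; exact Hp.
Qed.
End Frame.

(** * Rigidity when [X . X_t] is constant on [t = T] *)

Section Rigidity.
Variables (T b l : R) (X : R -> R -> vec3).
Hypothesis HX : fb_annulus T b X.
Hypothesis Hcrit : T * tanh T = 1.
Hypothesis Hl : forall th, dot3 (X T th) (D_t X T th) = l.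

Let HT : 0 < T < b := fb_T T b X HX.
Let HS : smooth3 b X := fb_smooth T b X HX.
Let HTb : - b < T < b.
Proof. lra. Qed.
Let top : on_boundary T T := or_introl eq_refl.
Let bot : on_boundary T (- T) := or_intror eq_refl.
Let g (s : R) : vec3 := X T s.
Let g1 (s : R) : vec3 := D_th X T s.
Let g2 (s : R) : vec3 := D_th (D_th X) T s.
Let g3 (s : R) : vec3 := D_th (D_th (D_th X)) T s.
Let k : R := dot3 (g2 0) (g2 0).

Let l_pos : 0 < l.
Proof.
  pose proof (fb_outward T b X HX T 0 top) as H; rewrite Hl in H.
  apply (Rmult_lt_reg_l T); lra.
Qed.

Let D0 (s : R) : is_derive3 g s (g1 s).
Proof. apply (smooth3_is_derive_th b X T s HS HTb). Qed.
Let D1 (s : R) : is_derive3 g1 s (g2 s).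
Proof. apply (smooth3_is_derive_th b _ T s (smooth3_D_th b X HS) HTb). Qed.
Let D2 (s : R) : is_derive3 g2 s (g3 s).
Proof. apply (smooth3_is_derive_th b _ T s (smooth3_D_th b _ (smooth3_D_th b X HS)) HTb). Qed.
Let H00 (s : R) : dot3 (g s) (g s) = 1.
Proof. apply (fb_sphere T b X HX T s top). Qed.
Let H11 (s : R) : dot3 (g1 s) (g1 s) = l * l.
Proof.
  unfold g1; rewrite <- (fb_conf T b X HX T s) by lra.
  rewrite (boundary_speed T b X HX T s top), Hl; reflexivity.
Qed.

(** On [t = T] one has [X_tt = - g''] and [X_tth = l g'], so [hopf_const] says that [|g''|^2 - l^4]
    does not depend on [s]. *)
Let H22 (s : R) : dot3 (g2 s) (g2 s) = k.
Proof.
  assert (Hn : forall v, D_t X T v = scal3 l (g v)).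
  { intros v; rewrite (fb_normal T b X HX T v top), Hl; reflexivity. }
  assert (E1 : forall v, D_th (D_t X) T v = scal3 l (g1 v)).
  { intros v; apply (is_derive3_unique (fun s => D_t X T s) (fun s => scal3 l (g s)) v); [exact Hn | |].
    - apply (smooth3_is_derive_th b _ T v (smooth3_D_t b X HS) HTb).
    - intros c Hc; rewrite coord_scal3 by exact Hc.
      apply (is_derive_ext (fun u => l * c (g u))); [intros; symmetry; apply coord_scal3, Hc|].
      apply is_derive_scal, D0, Hc. }
  assert (E2 : forall v, D_t (D_t X) T v = scal3 (-1) (g2 v)).
  { intros v; apply coord_ext; intros c Hc; rewrite coord_scal3 by exact Hc.
    pose proof (fb_harm T b X HX T v c ltac:(lra) Hc); unfold g2; lra. }
  pose proof (hopf_const T b X HX s 0) as E.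
  rewrite !E1, !E2, !dot3_scal_l, !dot3_scal_r, !H11 in E; unfold k; lra.
Qed.

(** The angular frequency: [curve_third] reads [g''' = - w^2 g']. *)
Let w : R := sqrt k / l.

Let k_ge : l * l * (l * l) <= k := curve_accel_ge g g1 g2 l k l_pos D0 D1 H00 H11 H22.

Let w_sqr : w * w = k / (l * l).
Proof.
  assert (0 < l * l) by (apply Rmult_lt_0_compat; exact l_pos).
  unfold w; replace (sqrt k / l * (sqrt k / l)) with ((sqrt k * sqrt k) / (l * l)) by (field; lra).
  rewrite sqrt_sqrt; [reflexivity | nra].
Qed.

Let w_ge : l <= w.
Proof.
  assert (Hl2 : 0 < l * l) by (apply Rmult_lt_0_compat; exact l_pos).
  assert (0 <= w) by (unfold w; apply Rmult_le_pos; [apply sqrt_pos | left; apply Rinv_0_lt_compat, l_pos]).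
  assert (l * l <= w * w).
  { rewrite w_sqr; apply (Rmult_le_reg_r (l * l)); [exact Hl2|].
    replace (k / (l * l) * (l * l)) with k by (field; lra); exact k_ge. }
  pose proof l_pos; nra.
Qed.

Let w_pos : 0 < w.
Proof. pose proof l_pos; pose proof w_ge; lra. Qed.

(** The centre of the boundary circle: [g'' + w^2 g] is constant, and [C] is this constant divided
    by [w^2]. *)
Let C : vec3 := add3 (g 0) (scal3 (/ (w * w)) (g2 0)).
Let V (s : R) : vec3 := add3 (g s) (scal3 (-1) C).

Let g2_V (s : R) : g2 s = scal3 (- (w * w)) (V s).
Proof.
  apply coord_ext; intros c Hc; unfold V, C.
  rewrite coord_scal3, coord_add3, coord_scal3, coord_add3, coord_scal3 by exact Hc.
  assert (E : w * w * c (g s) + c (g2 s) = w * w * c (g 0) + c (g2 0)).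
  { apply (derive_eq_const_conv (fun s => w * w * c (g s) + c (g2 s)) (fun s => w * w * c (g1 s) + c (g3 s))).
    - intros v; apply (is_derive_plus (fun s => w * w * c (g s)) (fun s => c (g2 s)));
        [apply is_derive_scal, D0, Hc | apply D2, Hc].
    - intros v; rewrite (curve_third g g1 g2 g3 l k l_pos D0 D1 D2 H00 H11 H22 v), coord_scal3 by exact Hc.
      rewrite w_sqr; ring. }
  pose proof w_pos; replace (c (g2 s)) with (w * w * c (g 0) + c (g2 0) - w * w * c (g s)) by lra.
  field; lra.
Qed.

Let V_g2 (s : R) : V s = scal3 (- / (w * w)) (g2 s).
Proof.
  rewrite g2_V; apply coord_ext; intros c Hc; rewrite !coord_scal3 by exact Hc.
  pose proof w_pos; field; lra.
Qed.

(** The radius of the boundary circle, speed over frequency. *)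
Let r : R := l / w.

Let VV (s : R) : dot3 (V s) (V s) = r * r.
Proof.
  rewrite V_g2, dot3_scal_l, dot3_scal_r, H22.
  assert (Hk : k = w * w * (l * l)) by (rewrite w_sqr; pose proof l_pos; field; lra).
  rewrite Hk; unfold r; pose proof w_pos; field; lra.
Qed.

Let gV (s : R) : dot3 (g s) (V s) = r * r.
Proof.
  rewrite V_g2, dot3_scal_r, (curve_02 g g1 g2 l D0 D1 H00 H11).
  unfold r; pose proof w_pos; field; lra.
Qed.

Let g_V (s : R) : g s = add3 C (V s).
Proof.
  unfold V; apply coord_ext; intros c Hc; rewrite !coord_add3, coord_scal3 by exact Hc; ring.
Qed.

Let CV (s : R) : dot3 C (V s) = 0.
Proof.
  pose proof (gV s) as E; rewrite (g_V s), dot3_add_l, VV in E; lra.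
Qed.

Let CC : dot3 C C = 1 - r * r.
Proof.
  pose proof (H00 0) as E; rewrite (g_V 0), dot3_add_l, !dot3_add_r, VV, (dot3_comm (V 0)), CV in E; lra.
Qed.

Let V_g1 (s : R) : dot3 (V s) (g1 s) = 0.
Proof. rewrite V_g2, dot3_scal_l, dot3_comm, (curve_12 g1 g2 l D1 H11); ring. Qed.

Let C_g1 (s : R) : dot3 C (g1 s) = 0.
Proof.
  pose proof (curve_01 g g1 D0 H00 s) as E; rewrite (g_V s), dot3_add_l, V_g1 in E; lra.
Qed.

Let solution (t th : R) : - T <= t <= T ->
  X t th = add3 (scal3 (1 + l * (t - T)) C) (scal3 (profile T l w t) (V th)) /\
  D_t X t th = add3 (scal3 l C) (scal3 (profile' T l w t) (V th)) /\
  D_th X t th = scal3 (profile T l w t) (g1 th).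
Proof.
  intros Ht.
  assert (S : forall c, coord c ->
    c (X t th) = c C * (1 + l * (t - T)) + (c (g th) - c C) * profile T l w t /\
    c (D_t X t th) = c C * l + (c (g th) - c C) * profile' T l w t /\
    c (D_th X t th) = c (g1 th) * profile T l w t).
  { intros c Hc; unfold g1.
    change (c (X t th)) with (comp3 c X t th); change (c (g th)) with (comp3 c X T th).
    change (c (D_t X t th)) with (comp3 c (D_t X) t th).
    change (c (D_th X t th)) with (comp3 c (D_th X) t th).
    change (c (D_th X T th)) with (comp3 c (D_th X) T th).
    rewrite comp3_D_t, comp3_D_th by exact Hc.
    apply (cauchy_extension T b l w (c C) (comp3 c X) HT w_pos (HS c Hc)
      (harm_comp T b X HX c Hc)); [intros; apply (per_comp T b X HX); assumption | | |exact Ht].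
    - intros v; rewrite <- comp3_D_t by exact Hc; unfold comp3.
      rewrite (fb_normal T b X HX T v top), coord_scal3, Hl by exact Hc; reflexivity.
    - intros v; rewrite <- !comp3_D_th by exact Hc; unfold comp3.
      change (c (g2 v) = - (w * w) * (c (g v) - c C)).
      rewrite g2_V, coord_scal3 by exact Hc; unfold V; rewrite coord_add3, coord_scal3 by exact Hc; ring. }
  repeat split; apply coord_ext; intros c Hc; destruct (S c Hc) as (S1 & S2 & S3);
    [rewrite S1 | rewrite S2 | rewrite S3]; unfold V;
    rewrite ?coord_add3, ?coord_scal3, ?coord_add3, ?coord_scal3 by exact Hc; ring.
Qed.

Let parameters : w = 1 /\ l * T = 1.
Proof.
  destruct (solution (- T) 0 ltac:(lra)) as (S1 & S2 & S3).
  set (m := dot3 (X (- T) 0) (D_t X (- T) 0)).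
  assert (Hm : m < 0).
  { pose proof (fb_outward T b X HX (- T) 0 bot) as H; fold m in H.
    apply (Rmult_lt_reg_l T); lra. }
  assert (Hr : 0 < r) by (apply Rdiv_lt_0_compat; [exact l_pos | exact w_pos]).
  pose proof (fb_normal T b X HX (- T) 0 bot) as Hn; fold m in Hn.
  pose proof (fb_sphere T b X HX (- T) 0 bot) as Hs.
  pose proof (boundary_speed T b X HX (- T) 0 bot) as Hv; fold m in Hv.
  rewrite (fb_conf T b X HX (- T) 0 ltac:(lra)), S3, dot3_scal_l, dot3_scal_r, H11 in Hv.
  rewrite S1, S2 in Hn.
  rewrite S1, dot3_add_l, !dot3_add_r, !dot3_scal_l, !dot3_scal_r, (dot3_comm (V 0)), CV, CC, VV in Hs.
  (* Since [C] and [V 0] are orthogonal, pairing the free boundary condition with each of them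
     separates the affine part from the oscillating part. *)
  pose proof (f_equal (dot3 C) Hn) as N1; pose proof (f_equal (dot3 (V 0)) Hn) as N2.
  rewrite dot3_scal_r, !dot3_add_r, !dot3_scal_r, CV, CC in N1.
  rewrite dot3_scal_r, !dot3_add_r, !dot3_scal_r, (dot3_comm (V 0) C), CV, VV in N2.
  apply (critical_parameters T l w m); fold r.
  - pose proof l_pos; pose proof w_ge; lra.
  - lra.
  - exact Hcrit.
  - exact Hm.
  - lra.
  - lra.
  - lra.
  - apply (Rmult_eq_reg_l (r * r)); [lra | apply Rgt_not_eq; nra].
Qed.

Let V_circle (s : R) : V s = add3 (scal3 (cos s) (V 0)) (scal3 (sin s) (g1 0)).
Proof.
  destruct parameters as [Hw _].
  apply coord_ext; intros c Hc; rewrite coord_add3, !coord_scal3 by exact Hc.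
  rewrite (circular_motion (fun s => c (V s)) (fun s => c (g1 s))); [ring | |].
  - intros v; apply (is_derive_ext (fun v => c (g v) - c C)).
    + intros u; unfold V; rewrite coord_add3, coord_scal3 by exact Hc.
      match goal with |- @eq _ ?x ?y => change (@eq R x y) end; ring.
    + replace (c (g1 v)) with (minus (c (g1 v)) 0) by (unfold minus, plus, opp; simpl; ring).
      apply (is_derive_minus (fun v => c (g v)) (fun _ => c C)); [apply D0, Hc | apply (is_derive_const (c C) v)].
  - intros v; replace (- c (V v)) with (c (g2 v)); [apply D1, Hc|].
    rewrite g2_V, coord_scal3, Hw by exact Hc; ring.
Qed.

(** From [l T = 1 = T tanh T] follows [l = tanh T], and the addition formulas collapse the
    profile. *)
Let profile_critical (t : R) : profile T l w t = cosh t / cosh T.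
Proof.
  destruct parameters as [Hw HlT].
  pose proof (cosh_gt_0 T) as Hc; pose proof (cosh_sqr T) as Hc2.
  assert (Hlt : l = sinh T / cosh T).
  { apply (Rmult_eq_reg_r T); [|lra]; rewrite HlT, <- Hcrit; unfold tanh; ring. }
  unfold profile; rewrite Hw, Rmult_1_l, cosh_minus, sinh_minus, Hlt.
  apply (Rmult_eq_reg_r (cosh T)); [|lra].
  replace (cosh t / cosh T * cosh T) with (cosh t) by (field; lra).
  replace ((cosh t * cosh T - sinh t * sinh T + sinh T / cosh T / 1 * (sinh t * cosh T - cosh t * sinh T)) * cosh T)
    with (cosh t * (cosh T * cosh T - sinh T * sinh T)) by (field; lra).
  rewrite Hc2; ring.
Qed.

Theorem fb_annulus_rigid : congruent_in_ball (image_annulus T X) (critical_catenoid T).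
Proof.
  destruct parameters as [Hw HlT].
  pose proof (cosh_gt_0 T) as Hc; pose proof (cosh_sqr T) as Hc2.
  assert (Hr : r = l) by (unfold r; rewrite Hw; field).
  assert (Hl2 : l = / T) by (apply (Rmult_eq_reg_r T); [rewrite HlT; field|]; lra).
  assert (Hcc : cosh T * cosh T * (1 - l * l) = 1).
  { assert (sinh T = l * cosh T).
    { apply (Rmult_eq_reg_r (T / cosh T)); [|apply Rgt_not_eq, Rdiv_lt_0_compat; lra].
      replace (l * cosh T * (T / cosh T)) with (l * T) by (field; lra).
      rewrite HlT, <- Hcrit; unfold tanh; field; lra. }
    rewrite H in Hc2; lra. }
  assert (HTl : T * (T * (l * l)) = 1) by (replace (T * (T * (l * l))) with ((l * T) * (l * T)) by ring; rewrite HlT; ring).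
  (* The scalings normalize: [V 0] and [g1 0] have length [l = 1 / T], and [C] has length
     [sqrt (1 - l^2) = 1 / cosh T]. *)
  set (e1 := scal3 T (V 0)); set (e2 := scal3 T (g1 0)); set (e3 := scal3 (cosh T) C).
  assert (F11 : dot3 e1 e1 = 1) by (unfold e1; rewrite dot3_scal_l, dot3_scal_r, VV, Hr; lra).
  assert (F22 : dot3 e2 e2 = 1) by (unfold e2; rewrite dot3_scal_l, dot3_scal_r, H11; lra).
  assert (F33 : dot3 e3 e3 = 1) by (unfold e3; rewrite dot3_scal_l, dot3_scal_r, CC, Hr; lra).
  assert (F12 : dot3 e1 e2 = 0) by (unfold e1, e2; rewrite dot3_scal_l, dot3_scal_r, V_g1; ring).
  assert (F13 : dot3 e1 e3 = 0) by (unfold e1, e3; rewrite dot3_scal_l, dot3_scal_r, dot3_comm, CV; ring).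
  assert (F23 : dot3 e2 e3 = 0) by (unfold e2, e3; rewrite dot3_scal_l, dot3_scal_r, dot3_comm, C_g1; ring).
  assert (HF : forall t th, - T <= t <= T -> frame_coords e1 e2 e3 (X t th) = catenoid T t th).
  { intros t th Ht; destruct (solution t th Ht) as (S1 & _).
    rewrite S1, profile_critical, V_circle; unfold frame_coords, e1, e2, e3, catenoid.
    rewrite !dot3_scal_r, !dot3_add_l, !dot3_scal_l, !dot3_add_l, !dot3_scal_l.
    rewrite (dot3_comm (g1 0) C), (dot3_comm (g1 0) (V 0)), (dot3_comm (V 0) C), CV, C_g1, V_g1, CC, VV, H11, Hr.
    unfold scal3, vx, vy, vz; simpl; f_equal; [f_equal|].
    - rewrite Hl2; field; lra.
    - rewrite Hl2; field; lra.
    - replace (cosh T * ((1 + l * (t - T)) * (1 - l * l) + cosh t / cosh T * (cos th * 0 + sin th * 0)))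
        with ((1 + l * (t - T)) * (cosh T * cosh T * (1 - l * l)) / cosh T) by (field; lra).
      rewrite Hcc, Hl2; field; lra. }
  exists (frame_coords e1 e2 e3); split; [|split].
  - apply frame_coords_isometry; assumption.
  - apply frame_coords_ball; assumption.
  - intros p; split.
    + intros (q & (t & th & Ht & <-) & <-); exists t, th; split; [exact Ht | symmetry; apply HF, Ht].
    + intros (t & th & Ht & <-); exists (X t th); split; [exists t, th; auto | apply HF, Ht].
Qed.
End Rigidity.

(** * From the geometric hypotheses to harmonic maps *)

(** Both [X_t] and the outward direction in [t] change sign, so the boundary conditions are kept;
    the second derivatives are unchanged. *)
Lemma fb_annulus_reflect (T b : R) (X : R -> R -> vec3) :
  fb_annulus T b X -> fb_annulus T b (reflect X).
Proof.
  intros HX; pose proof (fb_T T b X HX) as HT; pose proof (fb_smooth T b X HX) as HS.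
  assert (D1 : forall t th, - T <= t <= T -> D_t (reflect X) t th = scal3 (-1) (D_t X (- t) th)).
  { intros t th Ht; apply coord_ext; intros c Hc; rewrite coord_scal3 by exact Hc.
    change (comp3 c (D_t (reflect X)) t th = -1 * comp3 c (D_t X) (- t) th).
    rewrite !comp3_D_t by exact Hc.
    change (comp3 c (reflect X)) with (reflect (comp3 c X)).
    rewrite (d_t_reflect b); [ring | apply HS, Hc | lra]. }
  assert (Hb : forall t, on_boundary T t -> on_boundary T (- t) /\ - T <= t <= T)
    by (intros t [-> | ->]; (split; [unfold on_boundary|]; lra)).
  split.
  - exact HT.
  - intros c Hc; apply (smooth_reflect b (comp3 c X)), HS, Hc.
  - intros t th Ht; apply (fb_per T b X HX); lra.
  - intros t th Ht; rewrite D1, dot3_scal_l, dot3_scal_r by exact Ht.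
    rewrite (fb_conf T b X HX (- t) th) by lra.
    change (D_th (reflect X) t th) with (D_th X (- t) th); ring.
  - intros t th c Ht Hc.
    pose proof (fb_harm T b X HX (- t) th c ltac:(lra) Hc) as H.
    change (D_th (D_th (reflect X)) t th) with (D_th (D_th X) (- t) th).
    replace (c (D_t (D_t (reflect X)) t th)) with (c (D_t (D_t X) (- t) th)); [exact H|].
    change (comp3 c (D_t (D_t X)) (- t) th = comp3 c (D_t (D_t (reflect X))) t th).
    rewrite !comp3_D_t by exact Hc.
    change (comp3 c (reflect X)) with (reflect (comp3 c X)).
    symmetry; apply (d_tt_reflect b); [apply HS, Hc | lra].
  - intros t th Ht; apply (fb_sphere T b X HX), Hb, Ht.
  - intros t th Ht; destruct (Hb t Ht) as [Hb1 Hb2]; rewrite D1 by exact Hb2.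
    rewrite (fb_normal T b X HX (- t) th Hb1) at 1.
    unfold reflect; apply coord_ext; intros c Hc; rewrite !coord_scal3, dot3_scal_r by exact Hc; ring.
  - intros t th Ht; destruct (Hb t Ht) as [Hb1 Hb2]; rewrite D1 by exact Hb2.
    pose proof (fb_outward T b X HX (- t) th Hb1).
    unfold reflect; rewrite dot3_scal_r; lra.
Qed.

(** Constant speed fixes the square of [X . X_t]; [fb_outward] fixes its sign. *)
Lemma boundary_factor_const (T b t : R) (X : R -> R -> vec3) :
  fb_annulus T b X -> on_boundary T t ->
  (forall th, dot3 (D_t X t th) (D_t X t th) = dot3 (D_t X t 0) (D_t X t 0)) ->
  forall th, dot3 (X t th) (D_t X t th) = dot3 (X t 0) (D_t X t 0).
Proof.
  intros HX Ht H th; specialize (H th).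
  rewrite !(boundary_speed T b X HX t _ Ht) in H.
  pose proof (fb_outward T b X HX t th Ht) as P; pose proof (fb_outward T b X HX t 0 Ht) as P0.
  set (m := dot3 (X t th) (D_t X t th)) in *; set (m0 := dot3 (X t 0) (D_t X t 0)) in *.
  assert (E : (m - m0) * (t * m + t * m0) = 0).
  { replace ((m - m0) * (t * m + t * m0)) with (t * (m * m - m0 * m0)) by ring; rewrite H; ring. }
  apply Rmult_integral in E; lra.
Qed.

(** The coordinates [(t, th)] are isothermal for the catenoid, hence for every metric conformal to
    its own; the factor depends on [t] alone. *)
Lemma catenoid_metric (T t th : R) :
  dot3 (D_t (catenoid T) t th) (D_t (catenoid T) t th) = (/ (T * cosh T) * cosh t) ^ 2 /\
  dot3 (D_th (catenoid T) t th) (D_th (catenoid T) t th) = (/ (T * cosh T) * cosh t) ^ 2 /\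
  dot3 (D_t (catenoid T) t th) (D_th (catenoid T) t th) = 0.
Proof.
  set (a := / (T * cosh T)).
  assert (Et : D_t (catenoid T) t th = scal3 a (sinh t * cos th, sinh t * sin th, 1)).
  { assert (L : forall k, is_derive (fun s => a * (cosh s * k)) t (a * (sinh t * k))).
    { intros k; apply is_derive_scal, (is_derive_ext (fun s => k * cosh s)); [intros; apply Rmult_comm|].
      rewrite Rmult_comm; apply is_derive_scal, is_derive_cosh. }
    apply vec3_ext; apply is_derive_unique.
    - apply L.
    - apply L.
    - apply (is_derive_scal (fun s => s)), (is_derive_id t). }
  assert (Eth : D_th (catenoid T) t th = scal3 a (cosh t * - sin th, cosh t * cos th, 0)).
  { apply vec3_ext; apply is_derive_unique.
    - apply (is_derive_scal (fun s => cosh t * cos s)), is_derive_scal, is_derive_cos.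
    - apply (is_derive_scal (fun s => cosh t * sin s)), is_derive_scal, is_derive_sin.
    - apply (is_derive_scal (fun _ => t)), (is_derive_const t th). }
  rewrite Et, Eth; pose proof (cosh_sqr t) as Hc; pose proof (sin2_cos2 th) as Hs; unfold Rsqr in Hs.
  vec; repeat split.
  - replace (a * (sinh t * cos th) * (a * (sinh t * cos th)) + a * (sinh t * sin th) * (a * (sinh t * sin th)) + a * 1 * (a * 1))
      with (a * a * (sinh t * sinh t * (sin th * sin th + cos th * cos th) + 1)) by ring.
    rewrite Hs.
    replace (a * cosh t * (a * cosh t * 1)) with (a * a * (cosh t * cosh t)) by ring; rewrite Hc; ring.
  - replace (a * (cosh t * - sin th) * (a * (cosh t * - sin th)) + a * (cosh t * cos th) * (a * (cosh t * cos th)) + a * 0 * (a * 0))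
      with (a * a * (cosh t * cosh t) * (sin th * sin th + cos th * cos th)) by ring.
    rewrite Hs; ring.
  - ring.
Qed.

Lemma induced_metric_frame (X : R -> R -> vec3) (t th : R) :
  induced_metric X t th (1, 0) (1, 0) = dot3 (D_t X t th) (D_t X t th) /\
  induced_metric X t th (0, 1) (0, 1) = dot3 (D_th X t th) (D_th X t th) /\
  induced_metric X t th (1, 0) (0, 1) = dot3 (D_t X t th) (D_th X t th).
Proof.
  unfold induced_metric, Defs.differential; cbn [fst snd].
  rewrite !dot3_add_l, !dot3_scal_l, !dot3_add_r, !dot3_scal_r; repeat split; ring.
Qed.

Lemma smooth_map_smooth3 (T : R) (X : R -> R -> vec3) :
  smooth_map T X -> exists b, T < b /\ smooth3 b X.
Proof.
  intros ((_ & ex & Hx & Sx) & (_ & ey & Hy & Sy) & (_ & ez & Hz & Sz)).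
  set (e := Rmin ex (Rmin ey ez)).
  assert (He : 0 < e) by (repeat apply Rmin_glb_lt; assumption).
  pose proof (Rmin_l ex (Rmin ey ez)); pose proof (Rmin_r ex (Rmin ey ez)).
  pose proof (Rmin_l ey ez); pose proof (Rmin_r ey ez); fold e in H, H0.
  exists (T + e); split; [lra|].
  intros c [-> | [-> | ->]] k; (eapply Ck_on_sub; [|first [apply Sx | apply Sy | apply Sz]]);
    unfold strip; intros; lra.
Qed.

(** The tension field of a conformal map is normal, and its normal component is
    a multiple of the mean curvature. *)
Lemma conformal_minimal_harmonic (T b : R) (X : R -> R -> vec3) :
  0 < T < b -> smooth3 b X -> minimal T X ->
  (forall t th, - T <= t <= T -> dot3 (D_t X t th) (D_t X t th) = dot3 (D_th X t th) (D_th X t th)) ->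
  (forall t th, - T <= t <= T -> dot3 (D_t X t th) (D_th X t th) = 0) ->
  (forall t th, - T <= t <= T -> 0 < dot3 (D_t X t th) (D_t X t th)) ->
  forall t th c, - T <= t <= T -> coord c ->
    c (D_t (D_t X) t th) + c (D_th (D_th X) t th) = 0.
Proof.
  intros HT HS Hmin HE HF Hpos t th c Ht Hc.
  pose proof (smooth3_D_t b X HS) as HSt; pose proof (smooth3_D_th b X HS) as HSh.
  apply (continuity_closure (fun t => c (D_t (D_t X) t th) + c (D_th (D_th X) t th)) T t);
    [lra | | | exact Ht].
  2:{ apply continuity_pt_plus; apply (continuity_2d_pt_t (fun t th => c (_ t th)));
      apply (smooth3_continuous b);
      first [exact Hc | lra | apply smooth3_D_t, HSt | apply smooth3_D_th, HSh]. }
  clear t Ht; intros t Ht; rewrite <- coord_add3 by exact Hc.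
  assert (Htb : - b < t < b) by lra.
  assert (Htc : - T <= t <= T) by lra.
  pose proof (smooth3_is_derive_t b _ t th HSt Htb) as Dtt.
  pose proof (smooth3_is_derive_th b _ t th HSt Htb) as Dth.
  pose proof (smooth3_is_derive_th_t b X t th HS Htb) as Dht.
  pose proof (smooth3_is_derive_th b _ t th HSh Htb) as Dhh.
  (* Differentiating [|X_t|^2 = |X_th|^2] and [X_t . X_th = 0] in both variables shows that
     [X_tt + X_thth] is orthogonal to [X_t] and [X_th]. *)
  assert (Eh : 2 * dot3 (D_t X t th) (D_th (D_t X) t th) = 2 * dot3 (D_th X t th) (D_th (D_th X) t th)).
  { pose proof (derive_eq _ _ _ _ _ (fun s => HE t s Htc) (is_derive_dot3 _ _ _ _ _ Dth Dth)
      (is_derive_dot3 _ _ _ _ _ Dhh Dhh)) as E; cbv beta in E.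
    rewrite (dot3_comm (D_th (D_t X) t th)), (dot3_comm (D_th (D_th X) t th)) in E; lra. }
  assert (Et : 2 * dot3 (D_t X t th) (D_t (D_t X) t th) = 2 * dot3 (D_th X t th) (D_th (D_t X) t th)).
  { assert (E : locally t (fun s => dot3 (D_t X s th) (D_t X s th) = dot3 (D_th X s th) (D_th X s th))).
    { eapply filter_imp; [|apply (locally_in_strip T t Ht)]; intros; apply HE; lra. }
    pose proof (derive_eq_loc _ _ _ _ _ E (is_derive_dot3 _ _ _ _ _ Dtt Dtt)
      (is_derive_dot3 _ _ _ _ _ Dht Dht)) as E1; cbv beta in E1.
    rewrite (dot3_comm (D_th (D_t X) t th)), (dot3_comm (D_t (D_t X) t th)) in E1; lra. }
  assert (Fh : dot3 (D_th (D_t X) t th) (D_th X t th) + dot3 (D_t X t th) (D_th (D_th X) t th) = 0)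
    by apply (derive_eq_const _ _ _ _ (fun s => HF t s Htc) (is_derive_dot3 _ _ _ _ _ Dth Dhh)).
  assert (Ft : dot3 (D_t (D_t X) t th) (D_th X t th) + dot3 (D_t X t th) (D_th (D_t X) t th) = 0).
  { assert (E : locally t (fun s => dot3 (D_t X s th) (D_th X s th) = 0)).
    { eapply filter_imp; [|apply (locally_in_strip T t Ht)]; intros; apply HF; lra. }
    apply (derive_eq_loc _ _ _ _ _ E (is_derive_dot3 _ _ _ _ _ Dtt Dht)), (is_derive_const 0 t). }
  set (W := add3 (D_t (D_t X) t th) (D_th (D_th X) t th)).
  set (N := cross3 (D_t X t th) (D_th X t th)).
  specialize (Hpos t th Htc); specialize (HE t th Htc); specialize (HF t th Htc).
  assert (HN : dot3 N N = dot3 (D_t X t th) (D_t X t th) ^ 2).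
  { replace (dot3 N N) with (dot3 (D_t X t th) (D_t X t th) * dot3 (D_th X t th) (D_th X t th)
      - dot3 (D_t X t th) (D_th X t th) ^ 2) by (unfold N; vec; ring).
    rewrite HF, <- HE; ring. }
  assert (HNpos : 0 < dot3 N N) by (rewrite HN; nra).
  (* For [E = G] and [F = 0] the mean curvature is [W . N] times a positive factor. *)
  assert (HWN : dot3 W N = 0).
  { pose proof (Hmin t th Htc) as H; unfold mean_curvature, unit_normal in H; cbv zeta in H; fold N in H.
    rewrite <- HE, HF, !dot3_scal_r in H.
    assert (Hn : 0 < norm3 N) by (apply sqrt_lt_R0, HNpos).
    unfold W; rewrite dot3_add_l.
    set (s := dot3 (D_t X t th) (D_t X t th)) in *; set (n := norm3 N) in *.
    apply (Rmult_eq_reg_r (s * / n / (2 * (s * s)))).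
    - rewrite Rmult_0_l; etransitivity; [|exact H]; field; split; nra.
    - apply Rgt_not_eq; apply Rdiv_lt_0_compat; [apply Rdiv_lt_0_compat; assumption | nra]. }
  assert (Z : W = (0, 0, 0)).
  { apply (orthogonal_to_basis (D_t X t th) (D_th X t th) N); [fold N; lra | | | exact HWN];
      unfold W; rewrite dot3_add_l.
    - rewrite (dot3_comm (D_t (D_t X) t th)), (dot3_comm (D_th (D_th X) t th)).
      rewrite (dot3_comm (D_th (D_t X) t th)) in Fh; lra.
    - rewrite (dot3_comm (D_th (D_th X) t th)); lra. }
  rewrite Z; destruct Hc as [-> | [-> | ->]]; reflexivity.
Qed.

Lemma free_boundary_fb_annulus (T : R) (X : R -> R -> vec3) (phi : R -> R -> R) :
  0 < T -> free_boundary_minimal_immersion T X ->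
  conformal_factor T (catenoid T) X phi -> exists b, fb_annulus T b X.
Proof.
  intros HT (Hsm & _ & Hmin & _ & Hsph & Hfb) Hconf.
  destruct (smooth_map_smooth3 T X Hsm) as (b & Hb & HS).
  set (e := fun t th => exp (2 * phi t th) * (/ (T * cosh T) * cosh t) ^ 2).
  assert (He : forall t th, 0 < e t th).
  { intros; apply Rmult_lt_0_compat; [apply exp_pos|].
    apply pow_lt, Rmult_lt_0_compat; [|apply cosh_gt_0].
    apply Rinv_0_lt_compat, Rmult_lt_0_compat; [exact HT | apply cosh_gt_0]. }
  assert (HM : forall t th, - T <= t <= T ->
    dot3 (D_t X t th) (D_t X t th) = e t th /\ dot3 (D_th X t th) (D_th X t th) = e t th /\
    dot3 (D_t X t th) (D_th X t th) = 0).
  { intros t th Ht; unfold e.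
    destruct (induced_metric_frame X t th) as (<- & <- & <-).
    destruct (catenoid_metric T t th) as (C1 & C2 & C3).
    rewrite !(Hconf t th Ht).
    destruct (induced_metric_frame (catenoid T) t th) as (-> & -> & ->).
    rewrite C1, C2, C3; repeat split; ring. }
  (* In isothermal coordinates the exterior unit conormal is [d/dt] divided by [k], where [|k|] is
     the length of [X_t] and [k] has the sign of [t]. *)
  assert (Hbd : forall t th, on_boundary T t -> exists k, 0 < t * k /\ D_t X t th = scal3 k (X t th)).
  { intros t th Ht.
    assert (Hti : - T <= t <= T) by (destruct Ht as [-> | ->]; lra).
    destruct (HM t th Hti) as (M1 & _ & M3).
    set (s := sqrt (e t th)).
    assert (Hs : 0 < s) by (apply sqrt_lt_R0, He).
    assert (Hss : s * s = e t th) by (apply sqrt_sqrt; left; apply He).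
    (* The quotient [t / T] is 1 or -1 according to the boundary component. *)
    set (k := t / T * s).
    assert (Hk : k * k = e t th /\ 0 < t * k /\ k <> 0).
    { unfold k; destruct Ht as [-> | ->].
      - replace (T / T * s) with s by (field; lra); repeat split; [exact Hss | nra | lra].
      - replace (- T / T * s) with (- s) by (field; lra); repeat split; [lra | nra | lra]. }
    destruct Hk as (Hkk & Htk & Hk0).
    exists k; split; [exact Htk|].
    assert (Hd : Defs.differential X t th (/ k, 0) = scal3 (/ k) (D_t X t th)).
    { unfold Defs.differential; apply vec3_ext; vec; ring. }
    rewrite <- (Hfb t th (/ k, 0) Ht).
    - rewrite Hd; apply vec3_ext; vec; field; exact Hk0.
    - unfold exterior_unit_conormal, induced_metric; rewrite Hd; split; [|split].
      + rewrite dot3_scal_l, dot3_scal_r, M1, <- Hkk; field; exact Hk0.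
      + replace (Defs.differential X t th (0, 1)) with (D_th X t th).
        * rewrite dot3_scal_l, M3; ring.
        * unfold Defs.differential; apply vec3_ext; vec; ring.
      + simpl; replace (t * / k) with (t * k * / (k * k)) by (field; exact Hk0).
        apply Rmult_lt_0_compat; [exact Htk | apply Rinv_0_lt_compat; rewrite Hkk; apply He]. }
  assert (Hs1 : forall t th, on_boundary T t -> dot3 (X t th) (X t th) = 1).
  { intros t th Ht; pose proof (Hsph t th Ht) as H; unfold unit_sphere, norm3 in H.
    assert (0 <= dot3 (X t th) (X t th)) by (unfold dot3; nra).
    rewrite <- (sqrt_sqrt _ H0), H; ring. }
  exists b; split.
  - lra.
  - exact HS.
  - destruct Hsm as ((Px & _) & (Py & _) & (Pz & _)).
    intros t th Ht; apply vec3_ext; [apply Px | apply Py | apply Pz]; exact Ht.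
  - intros t th Ht; destruct (HM t th Ht) as (-> & -> & _); reflexivity.
  - apply (conformal_minimal_harmonic T b X); try assumption; [lra | | |];
      intros t th Ht; destruct (HM t th Ht) as (M1 & M2 & M3); rewrite ?M1, ?M2; auto.
  - exact Hs1.
  - intros t th Ht; destruct (Hbd t th Ht) as (k & _ & E).
    rewrite E, dot3_scal_r, (Hs1 t th Ht), Rmult_1_r; reflexivity.
  - intros t th Ht; destruct (Hbd t th Ht) as (k & Hk & E).
    rewrite E, dot3_scal_r, (Hs1 t th Ht), Rmult_1_r; exact Hk.
Qed.

Lemma conformal_speed_const (T t : R) (X : R -> R -> vec3) (phi : R -> R -> R) :
  conformal_factor T (catenoid T) X phi -> in_annulus T t -> constant_on_component t phi ->
  forall th, dot3 (D_t X t th) (D_t X t th) = dot3 (D_t X t 0) (D_t X t 0).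
Proof.
  intros Hconf Ht [c Hc] th.
  assert (E : forall v, dot3 (D_t X t v) (D_t X t v) = exp (2 * c) * (/ (T * cosh T) * cosh t) ^ 2).
  { intros v; rewrite <- (proj1 (induced_metric_frame X t v)), (Hconf t v Ht), Hc,
      (proj1 (induced_metric_frame (catenoid T) t v)), (proj1 (catenoid_metric T t v)); reflexivity. }
  rewrite !E; reflexivity.
Qed.

Theorem theorem1p2 (T0 : R) (hT0 : is_critical_T T0)
    (xbar : R -> R -> vec3) (phi : R -> R -> R)
    (hxbar : free_boundary_minimal_immersion T0 xbar)
    (hphi : Ck_annulus 4 T0 phi)
    (hconf : conformal_factor T0 (catenoid T0) xbar phi)
    (hconst : constant_on_component T0 phi \/ constant_on_component (- T0) phi) :
  congruent_in_ball (image_annulus T0 xbar) (critical_catenoid T0).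
Proof.
  destruct hT0 as [HT Hcrit].
  destruct (free_boundary_fb_annulus T0 xbar phi HT hxbar hconf) as [b HX].
  destruct hconst as [Hc | Hc].
  - apply (fb_annulus_rigid T0 b (dot3 (xbar T0 0) (D_t xbar T0 0)) xbar HX Hcrit).
    apply (boundary_factor_const T0 b); [exact HX | left; reflexivity |].
    apply (conformal_speed_const T0 T0 xbar phi hconf); [unfold in_annulus; lra | exact Hc].
  - pose proof (fb_annulus_reflect T0 b xbar HX) as HR.
    assert (Hrefl : congruent_in_ball (image_annulus T0 (reflect xbar)) (critical_catenoid T0)).
    { apply (fb_annulus_rigid T0 b (dot3 (reflect xbar T0 0) (D_t (reflect xbar) T0 0)) _ HR Hcrit).
      apply (boundary_factor_const T0 b); [exact HR | left; reflexivity |].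
      (* The speed is moved to the [th]-derivative, which commutes with the reflection by
         computation. *)
      intros th; rewrite !(fb_conf T0 b _ HR) by lra.
      change (dot3 (D_th xbar (- T0) th) (D_th xbar (- T0) th) =
        dot3 (D_th xbar (- T0) 0) (D_th xbar (- T0) 0)).
      rewrite <- !(fb_conf T0 b _ HX) by lra.
      apply (conformal_speed_const T0 (- T0) xbar phi hconf); [unfold in_annulus; lra | exact Hc]. }
    (* The same isometry serves, because the reflected map has the same image. *)
    destruct Hrefl as (Phi & H1 & H2 & H3); exists Phi; split; [exact H1 | split; [exact H2|]].
    intros p; rewrite <- (H3 p); split; intros (q & (t & th & Ht & <-) & <-);
      (eexists; split; [|reflexivity]); exists (- t), th; unfold in_annulus in *; (split; [lra|]).
    + unfold reflect; rewrite Ropp_involutive; reflexivity.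
    + reflexivity.
Qed.
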